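(* Let $(\lambda_n)_{n\geq 2}$ be a sequence of compositions with $\lambda_n$ a composition of $n$. If $U_{\lambda_n}$ converges in $\mathcal{U}^{(2)}$ to $U=(U_{\uparrow},U_{\downarrow})$, then for every composition $\mu$ (every vertex of $\mathcal{Z}$), $$K_{\mu}(\lambda_n)\longrightarrow p_{U}(\mu)\quad (n\to\infty).$$
   Context: A composition $\lambda$ of $n$ is a sequence $(\lambda_1,\dots,\lambda_r)$ of positive integers with $\sum\lambda_j=n$; its descent set is $D_\lambda=\{\lambda_1,\lambda_1+\lambda_2,\dots,\lambda_1+\dots+\lambda_{r-1}\}\subset[1,n-1]$. For a permutation $\sigma\in\mathfrak{S}_k$ (written as the word $\sigma(1)\cdots\sigma(k)$), $des(\sigma)=\{i:\sigma(i+1)<\sigma(i)\}$. The graded graph $\mathcal{Z}$ has as vertices of degree $n$ the compositions of $n$ (and the empty composition $\emptyset$ in degree 0, joined to $(1)$). For $\mu=(\mu_1,\dots,\mu_s)$, $\lambda=(\lambda_1,\dots,\lambda_r)$ with $|\lambda|=|\mu|+1$, there is an edge $\mu\nearrow\lambda$ iff either $r=s$ and $\lambda$ is obtained from $\mu$ by increasing exactly one part by one, or $r=s+1$ and there is $j$ with $\lambda_k=\mu_k$ for $k<j$, $\lambda_j+\lambda_{j+1}-1=\mu_j$, and $\lambda_{k+1}=\mu_k$ for $k>j$. Let $d(\mu,\lambda)$ be the number of paths $\mu=\nu_0\nearrow\nu_1\nearrow\cdots\nearrow\nu_m=\lambda$ (zero if $|\mu|>|\lambda|$), $d(\lambda)=d(\emptyset,\lambda)$,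 and the Martin kernel $K_\mu(\lambda)=d(\mu,\lambda)/d(\lambda)$. $\mathcal{U}^{(2)}$ is the set of pairs $(U_\uparrow,U_\downarrow)$ of disjoint open subsets of $]0,1[$, with metric $d((U_\uparrow,U_\downarrow),(V_\uparrow,V_\downarrow))=\max(d_{Haus}(U_\uparrow^c,V_\uparrow^c),d_{Haus}(U_\downarrow^c,V_\downarrow^c))$, complements taken in $[0,1]$ and $d_{Haus}$ the Hausdorff distance. Paintbox: for $U\in\mathcal{U}^{(2)}$ and $x_1,\dots,x_k\in[0,1]$, $\sigma_U(x_1,\dots,x_k)\in\mathfrak{S}_k$ is defined by: $\sigma^{-1}(i)<\sigma^{-1}(j)$ iff either ($x_i,x_j$ are not in a common connected component of $U_\uparrow$ or of $U_\downarrow$, and $x_i<x_j$), or ($x_i,x_j$ lie in the same component of $U_\uparrow$ and $i<j$), or ($x_i,x_j$ lie in the same component of $U_\downarrow$ and $j<i$). With $X_1,X_2,\dots$ i.i.d. uniform on $[0,1]$, set $\sigma_U(k)=\sigma_U(X_1,\dots,X_k)$. For a composition $\mu$ of $k$, $p_U(\mu)=\mathbb{P}(\sigma_U(k)=\sigma)$ for any $\sigma\in\mathfrak{S}_k$ with $des(\sigma)=D_\mu$ (this is known to depend only on $\mu$). For a composition $\lambda$ of $n\geq2$, let $I_s=[\frac{s-1}{n-1},\frac{s}{n-1}]$ for $1\le s\le n-1$ and $U_\lambda=(U_\uparrow(\lambda),U_\downarrow(\lambda))$ with $U_\uparrow(\lambda)=\mathrm{int}\bigcup_{s\notin D_\lambda}I_s$,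 $U_\downarrow(\lambda)=\mathrm{int}\bigcup_{s\in D_\lambda}I_s$. *)

(* Defs.v *)
From HB Require Import structures.
From mathcomp Require Import all_boot all_order all_algebra all_fingroup.
From mathcomp Require Import all_classical all_reals all_analysis.
Set Implicit Arguments. Unset Strict Implicit. Unset Printing Implicit Defensive.
Import Order.TTheory GRing.Theory Num.Theory.
Import numFieldNormedType.Exports.
Local Open Scope classical_set_scope.
Local Open Scope ring_scope.

Definition is_comp (n : nat) (mu : seq nat) : bool :=
  all (fun a => (0 < a)%N) mu && (sumn mu == n).

Definition Dcomp (mu : seq nat) : seq nat :=
  [seq sumn (take l mu) | l <- iota 1 (size mu).-1].

Fixpoint lists_len (l n : nat) : seq (seq nat) :=
  if l is l'.+1 then [seq i :: s | i <- iota 1 n, s <- lists_len l' n]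
  else [:: [::]].

(* all compositions of n (each has length <= n and parts <= n) *)
Definition comps (n : nat) : seq (seq nat) :=
  undup [seq s <- flatten [seq lists_len l n | l <- iota 0 n.+1] | sumn s == n].

Definition zedge (mu lam : seq nat) : bool :=
  [|| (mu == [::]) && (lam == [:: 1%N]),
      (size lam == size mu) &&
        [exists j : 'I_(size mu), lam == incr_nth mu j]
    | (size lam == (size mu).+1) && all (fun a => (0 < a)%N) lam &&
        [exists j : 'I_(size mu),
          [&& take j lam == take j mu,
              nth 0 lam j + nth 0 lam j.+1 == (nth 0 mu j).+1
            & drop j.+2 lam == drop j.+1 mu]]].

Fixpoint npaths (m : nat) (mu lam : seq nat) : nat :=
  if m is m'.+1 then
    \sum_(nu <- comps (sumn lam).-1) (zedge nu lam * npaths m' mu nu)%N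
  else (mu == lam : nat).

(* d(mu, lam): paths have length |lam| - |mu|; zero if |mu| > |lam| *)
Definition dZ (mu lam : seq nat) : nat := npaths (sumn lam - sumn mu) mu lam.

Definition martinK {R : realType} (mu lam : seq nat) : R :=
  (dZ mu lam)%:R / (dZ [::] lam)%:R.

Definition pword (k : nat) (s : 'S_k) : seq nat := [seq val (s p) | p <- enum 'I_k].

(* des(sigma) = { i in [1,k-1] : sigma(i+1) < sigma(i) } (1-based positions) *)
Definition pdes (k : nat) (s : 'S_k) : seq nat :=
  [seq i <- iota 1 k.-1 | (nth 0 (pword s) i < nth 0 (pword s) i.-1)%N].

Section U2.
Variable R : realType.

Definition compl01 (A : set R) : set R := `[0, 1] `\` A.

Definition dist_set (B : set R) (a : R) : R := inf [set `|a - b| | b in B].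

Definition hausdorff (A B : set R) : R :=
  Num.max (sup [set dist_set B a | a in A]) (sup [set dist_set A b | b in B]).

Definition dU2 (U V : set R * set R) : R :=
  Num.max (hausdorff (compl01 U.1) (compl01 V.1))
          (hausdorff (compl01 U.2) (compl01 V.2)).

Definition Iseg (n s : nat) : set R := `[(s.-1)%:R / (n.-1)%:R, s%:R / (n.-1)%:R].

Definition Ulam (lam : seq nat) : set R * set R :=
  let n := sumn lam in
  (interior (\bigcup_(s in [set s : nat | (1 <= s <= n.-1)%N /\ s \notin Dcomp lam])
               Iseg n s),
   interior (\bigcup_(s in [set s : nat | (1 <= s <= n.-1)%N /\ s \in Dcomp lam])
               Iseg n s)).

Definition samecomp (A : set R) (x y : R) : Prop := A x /\ connected_component A x y.

(* the event sigma_U(x_1,...,x_k) = sigma, for x = [:: x_1; ...; x_k] *)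
Definition paint_event (Uu Ud : set R) (k : nat) (s : 'S_k) : set (seq R) :=
  [set x | forall i j : 'I_k,
     let xi := nth 0 x i in let xj := nth 0 x j in
     ((s^-1)%g i < (s^-1)%g j)%N <->
     ( (~ (samecomp Uu xi xj \/ samecomp Ud xi xj) /\ xi < xj)
       \/ (samecomp Uu xi xj /\ (i < j)%N)
       \/ (samecomp Ud xi xj /\ (j < i)%N) )].

Fixpoint iter_int01 (k : nat) (f : seq R -> \bar R) : \bar R :=
  if k is k'.+1 then
    (\int[@lebesgue_measure R]_(t in `[(0%R:R), (1%R:R)]%classic) iter_int01 k' (fun s => f (t :: s)))%E
  else f [::].

(* P(sigma_U(X_1,...,X_k) = sigma), X_i i.i.d. uniform on [0,1] *)
Definition paint_prob (Uu Ud : set R) (k : nat) (s : 'S_k) : R :=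
  fine (iter_int01 k (fun x => (\1_(paint_event Uu Ud s) x)%:E)).

End U2.

(* Main.v *)
(** Let [W] be the set of permutations of [n] with descent set [D_lambda].  Counting
    paths by inserting the largest value, [K_mu(lambda)] is the probability that a
    uniform [w] in [W] shows the pattern [sigma] on its [k] smallest values.  Swapping
    two consecutive values that are not adjacent in [w] preserves descents, so the [k]
    values may be replaced by any other [k] values; take one uniformly from each of [k]
    consecutive blocks.

    If the descent word changes sign at position [c], then ignoring the sign there costs
    only a factor [n] (move the entry before the cut to the bottom or the top), and
    makes the set of values left of [c] a uniform [c]-subset.  Exponential tails of the
    hypergeometric law beat this factor: every block of values is spread over the
    positions left and right of [c] in proportion to their number.

    Cut [0,1] at finitely many points outside [Uu] and [Ud] into components of [Uu] or
    [Ud] and short intervals.  Such points are limits of sign changes, so the cells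
    containing the [k] values become independent and are chosen with probability equal
    to their length, while inside a component [w] is monotone.  Up to the event that two
    values share a short cell, this is the paintbox rule. *)
Require Import Defs.
From HB Require Import structures.
From mathcomp Require Import all_boot all_order all_algebra all_fingroup.
From mathcomp Require Import all_classical all_reals all_analysis measurable_realfun.
From mathcomp Require Import zify ring lra.
Set Implicit Arguments.
Unset Strict Implicit.
Unset Printing Implicit Defensive.
Import Order.TTheory GRing.Theory Num.Theory.

(** * Permutations by insertion of the largest value *)

(** The obstacle is dependence: in a random permutation of [W] the positions of the [k] smallest
    values are strongly correlated, and no joint law is computed. Independence comes instead from
    the sampling of values: for every single permutation, values drawn from different blocks are
    independent, and the cell of the value from block [i] is distributed like the cells within that
    block. What is left is a law of large numbers: for most permutations each block meets each cell
    in the right proportion. As blocks and cells are differences of initial segments, it is enough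
    to control, for finitely many pairs [(c, j)], the number of values below [j] among the first [c]
    positions.

    The cut has to sit at a sign change because an entry pushed to the bottom or the top becomes a
    local extremum; inside a run this would spoil the comparison on its other side.

    In words of signs [true] is a descent; sign [i], counted from 0, compares positions [i] and
    [i.+1]. *)

Definition descents (w : seq nat) : seq bool :=
  if w is a :: r then pairmap (fun x y => y < x) a r else [::].

Fixpoint insert_after (n a : nat) (r : seq nat) : seq (seq nat) :=
  (a :: n :: r) ::
  (if r is b :: r' then map (cons a) (insert_after n b r') else [::]).

Definition insertions (n : nat) (w : seq nat) : seq (seq nat) :=
  (n :: w) :: (if w is a :: r then insert_after n a r else [::]).

Fixpoint perms (n : nat) : seq (seq nat) :=
  if n is n'.+1 then flatten [seq insertions n' w | w <- perms n'] else [:: [::]].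

(** The effect on signs of a new maximum placed after the first letter: between two letters it turns
    their sign into an ascent followed by a descent, at the end it adds an ascent. In front, as in
    [peak_insertions], it adds a descent. *)
Fixpoint peak_after (s : seq bool) : seq (seq bool) :=
  if s is x :: s' then (false :: true :: s') :: map (cons x) (peak_after s')
  else [:: [:: false]].

Definition peak_insertions (s : seq bool) := (true :: s) :: peak_after s.

Fixpoint one_insertion (s e : seq bool) {struct e} : bool :=
  if e is b :: e' then
    (e' == s) || (if s is x :: s' then (b == x) && one_insertion s' e' else false)
  else false.

Lemma head_insert_after n a r w : w \in insert_after n a r -> exists t, w = a :: t.
Proof.
case: r => [|b r] /=; first by rewrite inE => /eqP ->; exists [:: n].
rewrite inE => /orP[/eqP ->|/mapP[t _ ->]]; by [exists (n :: b :: r) | exists t].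
Qed.

Lemma descents_insert_after n a r : all (fun x => x < n) (a :: r) ->
  map descents (insert_after n a r) = peak_after (descents (a :: r)).
Proof.
elim: r a => [|b r IH] a /=; first by move=> /andP[an _]; rewrite ltnNge ltnW.
move=> /and3P[an bn rn]; rewrite ltnNge (ltnW an) bn; congr (_ :: _).
have := IH b; rewrite /= bn rn => /(_ isT) <-.
rewrite -!map_comp; apply/eq_in_map => w /head_insert_after[t ->] //=.
Qed.

Lemma descents_insertions n a r : all (fun x => x < n) (a :: r) ->
  map descents (insertions n (a :: r)) = peak_insertions (descents (a :: r)).
Proof.
move=> H; rewrite /insertions map_cons descents_insert_after //=.
by case/andP: H => -> _.
Qed.

(** Turning a sign into [false], [true] inserts the opposite sign next to it. Conversely, an
    inserted [false] slides right through a run of [false] until it meets a [true] or the end, and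
    an inserted [true] slides left until it meets a [false] or the front; there it is a peak
    insertion. *)
Lemma mem_peak_insertions s e : (e \in peak_insertions s) = one_insertion s e.
Proof.
have F t : (false :: t) \in peak_after t.
  elim: t => [|[] t IH] //=; first by rewrite inE eqxx.
  by rewrite inE; apply/orP; right; apply: map_f.
have cons_inj_mem (x : bool) t (l : seq (seq bool)) : (x :: t \in map (cons x) l) = (t \in l).
  by rewrite mem_map // => ? ? [].
elim: s e => [|x s IH] e.
  by case: e => [|[] e] //=; rewrite !inE //= eqseq_cons /= ?orbF.
case: e => [|b e]; first by rewrite !inE /=; apply/negbTE/mapP => -[].
have {}IH : (e \in peak_insertions s) = one_insertion s e by exact: IH.
rewrite /peak_insertions inE /= inE -IH /peak_insertions inE.
apply/idP/idP.
  move=> /or3P[|/eqP[-> ->]|/mapP[t tI [-> ->]]].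
  - by rewrite eqseq_cons => /andP[_ ->].
  - by case: x; rewrite !eqxx ?orbT.
  - by rewrite tI eqxx !orbT.
move=> /orP[/eqP->|/andP[/eqP-> /orP[/eqP->|eI]]].
- case: b; first by rewrite eqxx.
  by case: x; rewrite ?eqxx ?orbT // cons_inj_mem F !orbT.
- by case: x; rewrite eqxx ?orbT.
- by rewrite cons_inj_mem eI !orbT.
Qed.

Lemma uniq_peak_insertions s : uniq (peak_insertions s).
Proof.
have N t : (true :: t) \notin peak_after t.
  elim: t => [|x t IH] //=; rewrite inE /=; apply/negP => /mapP[u uI [xE tE]].
  by move: IH; rewrite xE tE uI.
rewrite /peak_insertions /= N /=.
elim: s => [|x s IH] //=; rewrite map_inj_uniq ?IH ?andbT; last by move=> ? ? [].
apply/negP => /mapP[u uI [_ uE]]; by move: (N s); rewrite uE uI.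
Qed.

(** At most one slot for the maximum produces a given descent word. This matches the absence of
    multiple edges in the graph and makes path counts equal to counts of permutations. *)
Lemma count_descents_insertions n a r e : all (fun x => x < n) (a :: r) ->
  count (fun w => descents w == e) (insertions n (a :: r)) =
  one_insertion (descents (a :: r)) e.
Proof.
move=> H; rewrite -mem_peak_insertions -count_uniq_mem ?uniq_peak_insertions //.
by rewrite -(descents_insertions H) count_map.
Qed.

Lemma insertionsP n w u :
  reflect (exists l r, w = l ++ r /\ u = l ++ n :: r) (u \in insertions n w).
Proof.
have A a r t : reflect (exists l r', a :: r = a :: l ++ r' /\ t = a :: l ++ n :: r')
    (t \in insert_after n a r).
  elim: r a t => [|b r IH] a t /=.
    rewrite inE; apply: (iffP eqP) => [->|[[|? l] [r' [//= [<-] ->]]]] //.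
    by exists [::], [::].
  rewrite inE; apply: (iffP orP).
    case=> [/eqP->|/mapP[v /IH [l [r' [[->] ->]]] ->]].
      by exists [::], (b :: r).
    by exists (b :: l), r'.
  case=> [[|c l]] [r' [/= []]]; first by move=> <- ->; left.
  move=> -> rE ->; right; apply/mapP; exists (c :: l ++ n :: r') => //.
  by apply/IH; exists l, r'; rewrite rE.
rewrite /insertions inE; apply: (iffP orP).
  case=> [/eqP->|]; first by exists [::], w.
  by case: w => [|a w] // /A[l [r [-> ->]]]; exists (a :: l), r.
case=> [[|a l]] [r [-> ->]]; first by left.
by right; apply/A; exists l, r.
Qed.

Lemma mem_perms n w : (w \in perms n) = perm_eq w (iota 0 n).
Proof.
elim: n w => [|n IH] w.
  by rewrite inE; apply/eqP/idP => [->//|/perm_nilP].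
apply/flatten_mapP/idP => [[u]|pw].
  rewrite IH => pu /insertionsP[l [r [uE ->]]].
  rewrite -addn1 iotaD /= add0n perm_sym perm_catC perm_sym /=.
  by rewrite -cat1s perm_catCA /= perm_cons -uE.
have nw : n \in w by rewrite (perm_mem pw) mem_iota ltnSn.
case/splitPr: nw pw => l r pw; exists (l ++ r); last by apply/insertionsP; exists l, r.
rewrite IH; move: pw; rewrite -addn1 iotaD /= add0n perm_sym perm_catC perm_sym /=.
by rewrite -cat1s perm_catCA /= perm_cons.
Qed.

Lemma perms_uniq_seq n w : w \in perms n -> uniq w.
Proof. by rewrite mem_perms => /perm_uniq ->; rewrite iota_uniq. Qed.

Lemma perms_mem n w x : w \in perms n -> (x \in w) = (x < n).
Proof. by rewrite mem_perms => /perm_mem ->; rewrite mem_iota. Qed.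

Lemma perms_size n w : w \in perms n -> size w = n.
Proof. by rewrite mem_perms => /perm_size ->; rewrite size_iota. Qed.

Lemma uniq_insertions n w : n \notin w -> uniq (insertions n w).
Proof.
have A a r : n \notin a :: r -> uniq (insert_after n a r).
  elim: r a => [|b r IH] a //=; rewrite inE negb_or => /andP[na nb].
  rewrite map_inj_uniq ?IH ?andbT //; last by move=> ? ? [].
  apply/negP => /mapP[u /head_insert_after [t ->] [E _]].
  by move: nb; rewrite inE E eqxx.
case: w => [|a r] nw //; rewrite /insertions cons_uniq A // andbT.
apply/negP => /head_insert_after [t [E _]]; by move: nw; rewrite E inE eqxx.
Qed.

Lemma uniq_perms n : uniq (perms n).
Proof.
elim: n => [|n IH] //=.
have nn u : u \in perms n -> n \notin u by move=> /perms_mem ->; rewrite ltnn.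
have : {in perms n &, forall u v t, t \in insertions n u -> t \in insertions n v -> u = v}.
  move=> u v uP vP t /insertionsP[l [r [uE ->]]] /insertionsP[l' [r' [vE E]]].
  have f s t' : n \notin s ++ t' -> [seq x <- s ++ n :: t' | x != n] = s ++ t'.
    rewrite mem_cat negb_or => /andP[a b]; rewrite filter_cat /= eqxx /=.
    by congr (_ ++ _); apply/all_filterP/allP => x xs; apply: contraTneq xs => ->.
  rewrite uE vE -f -?uE ?nn // E f -?vE ?nn //.
move: IH nn; elim: (perms n) => [//|u s IH]; rewrite cons_uniq => /andP[us su] nn inj.
rewrite map_cons -cat1s flatten_cat [flatten [:: _]]cats0 cat_uniq.
rewrite uniq_insertions ?nn ?mem_head // IH //.
- rewrite andbT; apply/hasPn => t /flatten_mapP[v vs tv]; apply/negP => tu.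
  move: us; rewrite (inj u v _ _ t) ?vs ?mem_head // inE vs orbT //.
- by move=> v vs; apply: nn; rewrite inE vs orbT.
- by move=> v v' vs vs'; apply: inj; rewrite inE ?vs ?vs' orbT.
Qed.

(** * Compositions and descent words *)

Fixpoint cword (l : seq nat) : seq bool :=
  if l is a :: l' then
    nseq a.-1 false ++ (if l' is [::] then [::] else true :: cword l')
  else [::].

Fixpoint wcomp (s : seq bool) : seq nat :=
  if s is b :: s' then
    if b then 1 :: wcomp s' else (head 0 (wcomp s')).+1 :: behead (wcomp s')
  else [:: 1].

Lemma wcomp_neq0 s : wcomp s != [::].
Proof. by case: s => [|[] s]. Qed.

Lemma cwordK l : l != [::] -> all (fun a => 0 < a) l -> wcomp (cword l) = l.
Proof.
elim: l => [//|a l IH] _ /= /andP[a0 al].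
have E : wcomp (if l is [::] then [::] else true :: cword l) = 1 :: l.
  by case: l IH al => // b l IH bl; rewrite [wcomp _]/= -/(cword (b :: l)) IH.
by case: a a0 => // a _; elim: a => [|a IHa] //=; rewrite IHa.
Qed.

Lemma is_comp_wcomp s : is_comp (size s).+1 (wcomp s).
Proof.
rewrite /is_comp; elim: s => [|[] s] //=; rewrite ?add1n ?eqSS //.
by case: (wcomp s) => //= a l /andP[/andP[_ ->] /eqP <-]; rewrite ?addSn eqxx.
Qed.

Lemma wcompK s : cword (wcomp s) = s.
Proof.
elim: s => [|[] s IH] //=.
  by case: (wcomp s) (wcomp_neq0 s) IH => //= a l _ ->.
have /andP[] := is_comp_wcomp s.
by case: (wcomp s) (wcomp_neq0 s) IH => // -[] //= a l _ <-.
Qed.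

Lemma is_comp_neq0 n l : is_comp n.+1 l -> l != [::].
Proof. by case: l. Qed.

Lemma is_comp0 l : is_comp 0 l -> l = [::].
Proof. by case: l => // -[|a] l /andP[]. Qed.

(** Words do not distinguish [[::]] from [[:: 1]], both sent to the empty word; a common degree
    restores injectivity. *)
Lemma cword_inj n l l' : is_comp n l -> is_comp n l' -> cword l = cword l' -> l = l'.
Proof.
case: n => [/is_comp0 -> /is_comp0 -> //|n] cl cl' E.
rewrite -[l]cwordK ?(is_comp_neq0 cl) //; last by case/andP: cl.
by rewrite E cwordK ?(is_comp_neq0 cl') //; case/andP: cl'.
Qed.

Lemma size_cword n l : is_comp n l -> size (cword l) = n.-1.
Proof.
case: n => [/is_comp0 -> //|n cl].
have l0 := is_comp_neq0 cl; case/andP: cl => al /eqP sl.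
have := is_comp_wcomp (cword l); rewrite cwordK // => /andP[_].
by rewrite sl eqSS => /eqP <-.
Qed.

Lemma mem_Dcomp n l x : is_comp n l ->
  (x \in Dcomp l) = (0 < x) && nth false (cword l) x.-1.
Proof.
move=> /andP[al _]; elim: l al x => [|a [|b l] IH] //=.
- by move=> _ x; rewrite nth_nil andbF.
- by move=> _ x; rewrite cats0 nth_nseq if_same andbF.
move=> /andP[a0 al] x; have {}IH := IH al.
have -> : (x \in Dcomp [:: a, b & l]) = (x == a) || (a <= x) && (x - a \in Dcomp (b :: l)).
  rewrite /Dcomp /= inE addn0; congr (_ || _).
  rewrite -[2]/(1 + 1) iotaDl -map_comp.
  apply/mapP/andP => [[i iI ->]|[ax /mapP[i iI E]]].
    rewrite /= leq_addr addKn; split=> //; exact: (map_f _ iI).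
  exists i => //=; move: E => /= <-; by rewrite subnKC.
rewrite IH -/(cword (b :: l)) nth_cat nth_nseq size_nseq.
case: (ltngtP x a) => [xa|ax|->] /=.
- case: ifP => [_|H]; first by rewrite if_same andbF.
  by have -> : x = 0 by lia.
- rewrite subn_gt0 ax [x.-1 < _]ltnNge.
  have -> /= : a.-1 <= x.-1 by lia.
  have -> /= : 0 < x by lia.
  by have -> : x.-1 - a.-1 = (x - a).-1.+1 by lia.
- by rewrite a0 ltnn subnn.
Qed.

Lemma one_insertion_cons b s : one_insertion s (b :: s).
Proof. by rewrite /= eqxx. Qed.

Lemma one_insertion_cat p s e : one_insertion s e -> one_insertion (p ++ s) (p ++ e).
Proof. by elim: p => //= x p IH /IH ->; rewrite eqxx orbT. Qed.

Lemma one_insertion_nseq m C e : one_insertion (nseq m false ++ C) e ->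
  [\/ e = false :: nseq m false ++ C,
      exists2 i, i <= m & e = nseq i false ++ true :: nseq (m - i) false ++ C
    | exists C' e', [/\ exists b, C = b :: C' /\ e = nseq m false ++ b :: e' & one_insertion C' e']].
Proof.
elim: m e => [|m IH] [|b e] //=.
  case/orP => [/eqP ->|].
    case: b; [apply: Or32; exists 0 => // | by apply: Or31].
  case: C => // x C' /andP[/eqP -> H]; apply: Or33; exists C', e; split=> //.
  by exists x.
case/orP => [/eqP ->|/andP[/eqP -> /IH]].
  case: b; [apply: Or32; exists 0 => // | by apply: Or31].
case=> [->|[i im ->]|[C' [e' [[x [-> ->]] H]]]].
- by apply: Or31.
- by apply: Or32; exists i.+1.
- by apply: Or33; exists C', e'; split => //; exists x.
Qed.

Definition grows (mu lam : seq nat) :=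
  exists2 j, j < size mu & lam = incr_nth mu j.

Definition splits (mu lam : seq nat) := exists2 j, j < size mu &
  [/\ take j lam = take j mu, nth 0 lam j + nth 0 lam j.+1 = (nth 0 mu j).+1
    & drop j.+2 lam = drop j.+1 mu].

Lemma zedgeP mu lam : mu != [::] ->
  reflect (grows mu lam \/
           [/\ size lam = (size mu).+1, all (fun a => 0 < a) lam & splits mu lam])
          (zedge mu lam).
Proof.
move=> /negbTE mu0; rewrite /zedge mu0 /=; apply: (iffP orP).
  case=> [/andP[_ /existsP[j /eqP lE]]|/andP[/andP[/eqP sl al]] /existsP[j]].
    by left; exists j.
  by move=> /and3P[/eqP H1 /eqP H2 /eqP H3]; right; split=> //; exists j.
case=> [[j jm lE]|[-> -> [j jm [H1 H2 H3]]]].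
  left; rewrite {1}lE size_incr_nth jm eqxx /=.
  by apply/existsP; exists (Ordinal jm); rewrite lE.
right; rewrite eqxx /=; apply/existsP; exists (Ordinal jm) => /=.
by apply/and3P; split; apply/eqP.
Qed.

Lemma one_insertion_cword mu e : mu != [::] -> all (fun a => 0 < a) mu ->
  one_insertion (cword mu) e ->
  exists2 lam, cword lam = e & [/\ lam != [::], all (fun a => 0 < a) lam,
    sumn lam = (sumn mu).+1 &
    (grows mu lam \/ size lam = (size mu).+1 /\ splits mu lam)].
Proof.
elim: mu e => [//|a mu IH] e _ /= /andP[a0 am] /one_insertion_nseq.
case=> [->|[i im ->]|[C' [e' [[x [CE ->]] H]]]].
- exists (a.+1 :: mu); last by split => //; left; exists 0.
  by case: a a0 => //= a _; case: mu {IH am}.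
(* A descent after [i] ascents splits [a] into [i.+1] and [a - i], whose sum [a.+1] is what an edge
   asks for. *)
- exists [:: i.+1, a.-1 - i + 1 & mu] => /=; first by rewrite addn1.
  split => //; [by rewrite addn1 | by lia|].
  right; split=> //; exists 0 => //=; split => //=; lia.
- case: mu IH am CE => [//|b mu] IH am [<- CE]; rewrite -CE in H.
  have [lam <- [lam0 al sl E]] := IH _ isT am H.
  exists (a :: lam); first by case: lam lam0 {al sl E}.
  split => //=; [by rewrite a0 | by rewrite sl /= addnS |].
  case: E => [[j jm ->]|[sE [j jm [H1 H2 H3]]]].
    by left; exists j.+1.
  right; split; first by rewrite sE.
  by exists j.+1 => //=; rewrite H1; split.
Qed.

Lemma grows_one_insertion mu lam : all (fun a => 0 < a) mu -> grows mu lam ->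
  one_insertion (cword mu) (cword lam).
Proof.
move=> am [j jm ->]; elim: mu j am jm => [//|a mu IH] [|j] /= /andP[a0 am] jm.
  case: a a0 => //= a _; exact: one_insertion_cons.
have := IH j am jm; case: mu jm {IH am} => // b mu jm /=.
by case: j jm => [|j] jm H; apply: one_insertion_cat; rewrite /= H orbT.
Qed.

Lemma splits_one_insertion mu lam : size lam = (size mu).+1 ->
  all (fun a => 0 < a) lam -> splits mu lam ->
  one_insertion (cword mu) (cword lam).
Proof.
move=> + + [j]; elim: mu j lam => [//|a mu IH] [|j] /=.
  case=> [//|x [//|y lam]] [sl] /and3P[x0 y0 _] _ /= [_ E]; rewrite !drop0 => lE.
  have -> : a.-1 = x.-1 + y.-1 by lia.
  rewrite lE nseqD -catA; apply: one_insertion_cat; exact: one_insertion_cons.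
case=> [//|x lam] [sl] /= /andP[x0 al] jm [[-> tE] E dE].
have H := IH j lam sl al jm (And3 tE E dE).
apply: one_insertion_cat.
by case: mu {IH} sl jm H {tE E dE} => // b mu; case: lam {al} => // c lam _ _ H; rewrite /= -/(cword _) H orbT.
Qed.

(** The two kinds of edges are the two letters that can be inserted: an ascent lengthens a part, a
    descent splits one. This rule starts in degree 1; the edge from the empty composition leaves the
    empty word unchanged. *)
Lemma zedge_one_insertion n mu lam : is_comp n.+1 mu -> is_comp n.+2 lam ->
  zedge mu lam = one_insertion (cword mu) (cword lam).
Proof.
move=> cm cl; have m0 := is_comp_neq0 cm; have l0 := is_comp_neq0 cl.
case/andP: (cm) => am sm; case/andP: (cl) => al sl.
apply/zedgeP/idP => // [[]|].
- exact: grows_one_insertion.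
- by case=> H1 _; exact: splits_one_insertion.
move=> /(one_insertion_cword m0 am)[lam' E [_ al' sl' H]].
have <- : lam' = lam.
  by apply: (cword_inj (n := n.+2) _ cl E); rewrite /is_comp al' sl' (eqP sm) /=.
by case: H => [|[]]; [left | right].
Qed.

Lemma mem_lists_len l n s :
  (s \in lists_len l n) = (size s == l) && all (fun a => 0 < a <= n) s.
Proof.
elim: l s => [|l IH] [|a s] //=.
  by apply/negbTE/negP => /allpairsP[[x y] [_ _]].
rewrite eqSS; apply/allpairsP/idP => [[[x y] /= [xI yI [-> ->]]]|].
  by move: xI yI; rewrite mem_iota IH => xI /andP[-> ->]; rewrite !andbT.
move=> /and3P[sl an al]; exists (a, s); rewrite /= mem_iota IH sl al.
by split => //; move: an; rewrite add1n ltnS.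
Qed.

Lemma mem_comps n s : (s \in comps n) = is_comp n s.
Proof.
rewrite mem_undup mem_filter /is_comp andbC.
case: eqP => [<-|_]; last by rewrite !andbF.
rewrite !andbT; apply/flatten_mapP/idP => [[l _]|al].
  by rewrite mem_lists_len => /andP[_]; apply: sub_all => a /andP[].
exists (size s).
  rewrite mem_iota /= add0n ltnS.
  by elim: s al => //= a s IH /andP[a0 /IH]; lia.
rewrite mem_lists_len eqxx /=.
elim: s al => //= a s IH /andP[a0 /IH H]; rewrite a0 leq_addr /=.
by apply: sub_all H => b /andP[-> /leq_trans]; apply; exact: leq_addl.
Qed.

Lemma size_descents w : size (descents w) = (size w).-1.
Proof. by case: w => //= a r; rewrite size_pairmap. Qed.

Definition pattern_count n k (sg : seq nat) (e : seq bool) : nat :=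
  count (fun w => (descents w == e) && ([seq x <- w | x < k] == sg)) (perms n).

(** Induction on the length: the vertex before [lam] is the descent composition of the permutation
    without its largest letter, and that letter, being at least [k], is invisible to the pattern of
    the letters below [k]. A path from [mu] thus describes how a permutation is built up from
    [sg]. *)
Lemma npaths_pattern_count m k mu sg lam :
  is_comp k mu -> sg \in perms k -> descents sg = cword mu ->
  is_comp (m + k) lam -> npaths m mu lam = pattern_count (m + k) k sg (cword lam).
Proof.
move=> cm sP sE; elim: m lam => [|m IH] lam cl.
  rewrite /= /pattern_count add0n.
  have -> : (mu == lam) = (descents sg == cword lam).
    apply/eqP/eqP => [<- //|]; rewrite sE; exact: cword_inj cl.
  rewrite (_ : count _ _ = count (fun w => (descents sg == cword lam) && (w == sg)) (perms k)).
    case: (_ == cword lam) => /=; last by rewrite count_pred0.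
    by rewrite [RHS]count_uniq_mem ?uniq_perms // sP.
  apply: eq_in_count => w wP /=.
  have -> : [seq x <- w | x < k] = w.
    by apply/all_filterP/allP => x; rewrite (perms_mem x wP).
  by case: (w =P sg) => [->|_]; rewrite ?andbF.
rewrite /= (_ : (sumn lam).-1 = m + k); last by case/andP: cl => _ /eqP ->.
have cI nu : nu \in comps (m + k) -> is_comp (m + k) nu by rewrite mem_comps.
rewrite big_seq; under eq_bigr => nu /cI nuI do rewrite (IH nu nuI).
rewrite -big_seq /pattern_count addSn /= count_flatten -map_comp sumnE big_map.
have -> : \sum_(w <- perms (m + k)) (count (fun w => (descents w == cword lam) && ([seq x <- w | x < k] == sg)) \o insertions (m + k)) w
  = \sum_(w <- perms (m + k)) \sum_(nu <- comps (m + k))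
     zedge nu lam * ((descents w == cword nu) && ([seq x <- w | x < k] == sg)).
  apply: eq_big_seq => w wP; rewrite [LHS]/comp.
  transitivity (([seq x <- w | x < k] == sg) * count (fun w => descents w == cword lam) (insertions (m + k) w)).
    rewrite (eq_in_count (a2 := fun u => (descents u == cword lam) && ([seq x <- w | x < k] == sg))).
      case: (_ == sg); rewrite ?mul1n ?mul0n; last by rewrite (eq_count (a2 := pred0)) ?count_pred0 // => u; rewrite andbF.
      by apply: eq_count => u; rewrite andbT.
    move=> u /insertionsP[l [r [-> ->]]] /=; rewrite !filter_cat /=.
    by rewrite ltnNge leq_addl.
  (* Each permutation has exactly one descent composition, so the sum over [nu] has a single nonzero
     term. *)
  have [nu0 nuI nuE] : exists2 nu, nu \in comps (m + k) & forall nu', nu' \in comps (m + k) -> (descents w == cword nu') = (nu' == nu).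
    case E : (m + k) wP => [|n] wP.
      exists [::]; first by rewrite mem_comps.
      move=> nu'; rewrite mem_comps => /is_comp0 ->; rewrite eqxx.
      by move: wP; rewrite inE => /eqP ->.
    have cw : is_comp n.+1 (wcomp (descents w)).
      by have := is_comp_wcomp (descents w); rewrite size_descents (perms_size wP).
    exists (wcomp (descents w)); first by rewrite mem_comps.
    move=> nu'; rewrite mem_comps => cn; apply/eqP/eqP => [E'|->]; last by rewrite wcompK.
    by apply: (cword_inj cn cw); rewrite wcompK.
  transitivity (([seq x <- w | x < k] == sg) * zedge nu0 lam).
    congr (_ * _).
    case E : (m + k) wP cl nuI nuE => [|n] wP cl nuI nuE.
      have -> : lam = [:: 1].
        apply: (cword_inj cl); first by rewrite addSn E.
        by apply: size0nil; rewrite (size_cword cl) addSn E.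
      move: nuI wP; rewrite mem_comps => /is_comp0 ->.
      by rewrite inE => /eqP ->.
    rewrite addSn E in cl; rewrite mem_comps in nuI.
    rewrite (zedge_one_insertion nuI cl) -(eqP (_ : descents w == cword nu0)); last by rewrite nuE ?mem_comps.
    have := perms_size wP; case: w wP {nuE} => // a r wP _.
    apply: count_descents_insertions; apply/allP => x xw.
    by rewrite -(perms_mem x wP).
  rewrite (bigD1_seq nu0) ?undup_uniq //= nuE // eqxx /= mulnC.
  rewrite big1_seq ?addn0 // => nu /andP[nu1 nuI'].
  by rewrite nuE // (negbTE nu1) muln0.
rewrite exchange_big /=; apply: eq_bigr => nu _.
by rewrite -big_distrr /= -sum1_count big_mkcond.
Qed.

(** * Exchangeability of values *)

Lemma map_involution_perm (T : eqType) (s : seq T) (f : T -> T) :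
  uniq s -> {in s, forall x, f x \in s} -> {in s, forall x, f (f x) = x} ->
  perm_eq (map f s) s.
Proof.
move=> us fs ff; apply: uniq_perm => //.
  by rewrite map_inj_in_uniq // => x y xs ys E; rewrite -(ff x xs) E ff.
move=> x; apply/mapP/idP => [[y ys ->]|xs]; first exact: fs.
by exists (f x); rewrite ?fs ?ff.
Qed.

Lemma count_involution (T : eqType) (s : seq T) (f : T -> T) (p : pred T) :
  uniq s -> {in s, forall x, f x \in s} -> {in s, forall x, f (f x) = x} ->
  count p s = count (p \o f) s.
Proof.
by move=> us fs ff; rewrite -(seq.permP (map_involution_perm us fs ff)) count_map.
Qed.

Definition swapS (x y : nat) : nat :=
  if y == x then x.+1 else if y == x.+1 then x else y.

Lemma swapSK x : involutive (swapS x).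
Proof.
move=> y; rewrite /swapS; case: (eqVneq y x) => [->|yx]; first by rewrite eqxx; case: eqP; lia.
by case: (eqVneq y x.+1) => [->|ySx]; rewrite ?eqxx // (negbTE yx) (negbTE ySx).
Qed.

Lemma swapS_inj x : injective (swapS x).
Proof. exact: inv_inj (@swapSK x). Qed.

Lemma swapS_lt x u v : ~~ ((u == x) && (v == x.+1)) -> ~~ ((u == x.+1) && (v == x)) ->
  (swapS x u < swapS x v) = (u < v).
Proof. by rewrite /swapS; do 4 ?[case: eqP => ?]; lia. Qed.

Lemma map_perms n f w : {in gtn n &, injective f} -> {in gtn n, forall y, f y < n} ->
  w \in perms n -> map f w \in perms n.
Proof.
move=> fi fn wP; rewrite mem_perms.
have u : uniq (map f w).
  rewrite map_inj_in_uniq ?(perms_uniq_seq wP) // => y z.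
  by rewrite !(perms_mem _ wP) => yn zn; apply: fi.
apply: uniq_perm => //; first exact: iota_uniq.
have [||_ //] := uniq_min_size u (s2 := iota 0 n).
- by move=> y /mapP[z]; rewrite (perms_mem _ wP) mem_iota => /fn zn ->.
- by rewrite size_map size_iota (perms_size wP).
Qed.

Lemma swapS_perms n x w : x.+1 < n -> w \in perms n -> map (swapS x) w \in perms n.
Proof.
move=> xn; apply: map_perms => [y z _ _|y]; first exact: swapS_inj.
by rewrite !inE /swapS; do 2 ?[case: eqP => ?]; lia.
Qed.

Lemma nth_descents w i : i.+1 < size w ->
  nth false (descents w) i = (nth 0 w i.+1 < nth 0 w i).
Proof.
case: w => // a r; rewrite ltnS => ir /=.
by rewrite (nth_pairmap 0).
Qed.

Lemma eq_descents n w e : size w = n -> size e = n.-1 ->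
  reflect (forall i, i.+1 < n -> (nth 0 w i.+1 < nth 0 w i) = nth false e i)
          (descents w == e).
Proof.
move=> sw se; apply: (iffP eqP) => [<- i im|H].
  by rewrite nth_descents ?sw.
apply: (@eq_from_nth _ false); first by rewrite size_descents sw se.
move=> i; rewrite size_descents sw => im; rewrite nth_descents ?sw ?H; lia.
Qed.

Definition adjacent x (w : seq nat) := exists i, i.+1 < size w /\
  (nth 0 w i = x /\ nth 0 w i.+1 = x.+1 \/ nth 0 w i = x.+1 /\ nth 0 w i.+1 = x).

Lemma adjacent_swap x w : adjacent x w <-> adjacent x (map (swapS x) w).
Proof.
have H u : adjacent x u -> adjacent x (map (swapS x) u).
  move=> [i [im iE]]; exists i; rewrite size_map; split=> //.
  rewrite !(nth_map 0) //; last exact: ltnW.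
  by case: iE => -[-> ->]; rewrite /swapS !eqxx gtn_eqF //; [right|left].
split=> [|/H]; first exact: H.
by rewrite -map_comp (eq_map (g := id)) ?map_id // => y; rewrite /= swapSK.
Qed.

(** Exchanging the values [x] and [x.+1] affects only the comparison between these two, which the
    descents see exactly when they are neighbours; in that case the word is left alone. *)
Definition swap_values x w : seq nat :=
  if `[< adjacent x w >] then w else map (swapS x) w.

Lemma swap_valuesK x : involutive (swap_values x).
Proof.
move=> w; rewrite /swap_values.
case: (asboolP (adjacent x w)) => [H|H]; first by case: asboolP.
case: asboolP => [/(adjacent_swap x w).2 //|_].
by rewrite -map_comp (eq_map (g := id)) ?map_id // => y; rewrite /= swapSK.
Qed.

Lemma swap_values_perms n x w :
  x.+1 < n -> w \in perms n -> swap_values x w \in perms n.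
Proof. by move=> xn wP; rewrite /swap_values; case: ifP => // _; apply: swapS_perms. Qed.

Lemma descents_swap_values x w : descents (swap_values x w) = descents w.
Proof.
rewrite /swap_values; case: asboolP => // na.
apply/eqP/(eq_descents (n := size w)); rewrite ?size_map ?size_descents // => i im.
rewrite nth_descents // !(nth_map 0) //; last exact: ltnW.
by apply: swapS_lt; apply/negP => /andP[/eqP E1 /eqP E2]; apply: na;
  exists i; split=> //; [right|left].
Qed.

Definition has_pattern (sg v w : seq nat) : bool :=
  [seq y <- w | y \in v] == [seq nth 0 v i | i <- sg].

Lemma adjacent_split x w : adjacent x w -> exists l r,
  w = l ++ [:: x; x.+1] ++ r \/ w = l ++ [:: x.+1; x] ++ r.
Proof.
move=> [i [im iE]]; exists (take i w), (drop i.+2 w).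
have E : w = take i w ++ [:: nth 0 w i; nth 0 w i.+1] ++ drop i.+2 w.
  by rewrite -[LHS](cat_take_drop i) (drop_nth 0) ?(drop_nth 0 im) // ltnW.
by case: iE => -[E1 E2]; [left|right]; rewrite {1}E E1 E2.
Qed.

(** Away from adjacency everything is merely renamed. If [x] and [x.+1] are neighbours, the word
    stays but the observed value changes from [x.+1] to [x], that is, to the position next to it; no
    other observed value is passed, so the pattern is the same. *)
Lemma has_pattern_swap sg v x w : uniq w -> all (gtn (size v)) sg ->
  x \notin v -> x.+1 \in v ->
  has_pattern sg (map (swapS x) v) (swap_values x w) = has_pattern sg v w.
Proof.
move=> uw sgv xv xSv; rewrite /has_pattern.
have -> : [seq nth 0 (map (swapS x) v) i | i <- sg] = map (swapS x) [seq nth 0 v i | i <- sg].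
  rewrite -map_comp; apply/eq_in_map => i /(allP sgv) iv /=.
  by rewrite (nth_map 0).
have -> : [seq y <- swap_values x w | y \in map (swapS x) v] = map (swapS x) [seq y <- w | y \in v].
  rewrite /swap_values; case: asboolP => H; last first.
    rewrite filter_map; congr map; apply: eq_filter => y /=.
    by rewrite mem_map //; exact: swapS_inj.
  have F u : x \notin u -> x.+1 \notin u ->
      [seq y <- u | y \in map (swapS x) v] = map (swapS x) [seq y <- u | y \in v].
    move=> xu xSu; have fixu : {in u, forall y, swapS x y = y}.
      move=> y yu; rewrite /swapS; case: eqP => [E|_]; first by rewrite -E yu in xu.
      by case: eqP => // E; rewrite -E yu in xSu.
    rewrite [RHS](_ : _ = map id [seq y <- u | y \in v]) ?map_id.
      apply: eq_in_filter => y yu.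
      by rewrite -{1}(fixu y yu) mem_map //; exact: swapS_inj.
    by apply: map_id_in => y; rewrite mem_filter => /andP[_ yu]; apply: fixu.
  have xv' : x \in map (swapS x) v by apply/mapP; exists x.+1 => //; rewrite /swapS gtn_eqF // eqxx.
  have xSv' : x.+1 \notin map (swapS x) v.
    by apply/negP => /mapP[y yv E]; move: xv; rewrite (_ : x = y) ?yv //; move: E; rewrite /swapS; do 2 ?[case: eqP => ?]; lia.
  have [l [r [E|E]]] := adjacent_split H; rewrite E in uw *;
    move: uw; rewrite cat_uniq /= !inE !negb_or => /and3P[_ /and3P[xl xSl _]] /and3P[] /andP[_ xr] xSr _;
    by rewrite !filter_cat /= xv' xSv (negbTE xv) (negbTE xSv') map_cat /= !F // /swapS gtn_eqF // eqxx.
by apply/eqP/eqP => [|-> //]; exact: (inj_map (@swapS_inj x)).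
Qed.

Lemma downclosed_sorted v : sorted ltn v -> (forall x, x.+1 \in v -> x \in v) ->
  v = iota 0 (size v).
Proof.
move=> sv dv; have uv : uniq v by exact: sorted_uniq ltn_trans ltnn _ sv.
have sub : {subset v <= iota 0 (size v)}.
  move=> y yv; rewrite mem_iota /= add0n.
  have H : {subset iota 0 y.+1 <= v}.
    move=> z; rewrite mem_iota /= add0n ltnS => zy.
    rewrite -(subKn zy); elim: (y - z) => [|d IH]; first by rewrite subn0.
    case: (ltnP d y) => dy; last by rewrite (_ : y - d.+1 = y - d) //; lia.
    by apply: dv; rewrite subnSK.
  by have := uniq_leq_size (iota_uniq 0 y.+1) H; rewrite size_iota.
apply: (irr_sorted_eq ltn_trans ltnn sv (iota_ltn_sorted _ _)).
by have [] := uniq_min_size uv sub; rewrite ?size_iota.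
Qed.

(** Lowering an element [x.+1] of a finite set to a free [x] decreases the sum of the set, so
    repeating this ends at an initial segment. The sorted list [v] stands for the set. *)
Lemma swap_invariant_const (T : Type) n (g : seq nat -> T) :
  (forall v x, sorted ltn v -> all (gtn n) v -> x \notin v -> x.+1 \in v ->
     g (map (swapS x) v) = g v) ->
  forall v, sorted ltn v -> all (gtn n) v -> g v = g (iota 0 (size v)).
Proof.
move=> gi v; have [b vb] := ubnP (sumn v).
elim: b v vb => [//|b IH] v vb sv nv.
have [/hasP[y yv /andP[y0 yv']]|/hasPn dv] :=
  boolP (has (fun y => (0 < y) && (y.-1 \notin v)) v); last first.
  rewrite {1}(downclosed_sorted sv) // => x xv.
  by have := dv _ xv; rewrite /= negbK.
have xS : y.-1.+1 \in v by rewrite prednK.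
rewrite -(gi v y.-1) // -(size_map (swapS y.-1) v); apply: IH.
- have : sumn (map (swapS y.-1) v) < sumn v; last by lia.
  have uv : uniq v by exact: sorted_uniq ltn_trans ltnn _ sv.
  rewrite (perm_sumn (perm_to_rem xS)) (perm_sumn (perm_map _ (perm_to_rem xS))) /=.
  have -> : map (swapS y.-1) (rem y.-1.+1 v) = rem y.-1.+1 v.
    rewrite -[RHS]map_id; apply/eq_in_map => z; rewrite mem_rem_uniq // inE => /andP[/= z1 zv].
    by rewrite /swapS (negbTE z1); case: eqP => // E; rewrite -E zv in yv'.
  by rewrite ltn_add2r /swapS gtn_eqF // eqxx.
- rewrite sorted_map; apply: (sub_in_sorted (P := mem v)) sv => //.
    move=> a c av cv /= ac; rewrite swapS_lt //; apply/negP => /andP[/eqP E1 /eqP E2].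
      by rewrite -E1 av in yv'.
    by lia.
- apply/allP => z /mapP[u uv ->]; rewrite /swapS /=.
  have := allP nv _ uv; have := allP nv _ xS; rewrite /=.
  by do 2 ?[case: eqP => ?]; lia.
Qed.

Lemma count_pattern_sorted n sg e v : all (gtn (size v)) sg ->
  sorted ltn v -> all (gtn n) v ->
  count (fun w => (descents w == e) && has_pattern sg v w) (perms n) =
  count (fun w => (descents w == e) && has_pattern sg (iota 0 (size v)) w) (perms n).
Proof.
move=> sgv sv nv.
(* [swap_invariant_const] speaks of lists of all sizes, so the size condition on [sg] is made part
   of [g]. *)
pose g v := if all (gtn (size v)) sg then
  count (fun w => (descents w == e) && has_pattern sg v w) (perms n) else 0.
have := @swap_invariant_const nat n g _ v sv nv.
rewrite /g size_iota sgv; apply => u x su nu xu xSu; rewrite size_map.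
case: ifP => // sgu.
have xn : x.+1 < n by exact: (allP nu).
rewrite (count_involution _ (uniq_perms n) (f := swap_values x)); first last.
- by move=> w _; apply: swap_valuesK.
- by move=> w; apply: swap_values_perms.
apply: eq_in_count => w wP /=; rewrite descents_swap_values.
by rewrite has_pattern_swap // (perms_uniq_seq wP).
Qed.

(** * Cutting at a sign change *)

(** Sign [c] compares positions [c] and [c.+1]; a cut with [c] entries on its left is therefore
    treated with [descents_off c.-1]. *)
Definition descents_off (c : nat) (e : seq bool) (w : seq nat) : bool :=
  all (fun i => (i == c) || ((nth 0 w i.+1 < nth 0 w i) == nth false e i))
      (iota 0 (size w).-1).

Lemma descents_offP n c e w : size w = n ->
  reflect (forall i, i.+1 < n -> i != c ->
             (nth 0 w i.+1 < nth 0 w i) = nth false e i)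
          (descents_off c e w).
Proof.
move=> sw; rewrite /descents_off sw; apply: (iffP allP) => [H i im ic|H i].
  have := H i; rewrite mem_iota (negbTE ic) /= => /(_ _)/eqP; apply; lia.
rewrite mem_iota => im; case: eqP => //= /eqP ic; apply/eqP/H => //; lia.
Qed.

Fixpoint sublists (n c : nat) : seq (seq nat) :=
  if n is n'.+1 then
    sublists n' c ++ (if c is c'.+1 then [seq rcons v n' | v <- sublists n' c'] else [::])
  else if c is 0 then [:: [::]] else [::].

Lemma sorted_ltn_rcons v a : sorted ltn (rcons v a) = all (gtn a) v && sorted ltn v.
Proof. by rewrite !(sorted_pairwise ltn_trans) pairwise_rcons. Qed.

Lemma mem_sublists n c v :
  (v \in sublists n c) = [&& sorted ltn v, all (gtn n) v & size v == c].
Proof.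
elim: n c v => [|n IH] c v /=.
  by case: c => [|c]; case: v => [|a v] //; rewrite /= andbF.
rewrite mem_cat IH; case: (lastP v) => [|v' a].
  case: c => [|c] /=; rewrite ?orbF //.
  by apply/negbTE/negP => /mapP[[|]].
have -> : (rcons v' a \in if c is c'.+1 then [seq rcons u n | u <- sublists n c'] else [::])
    = [&& a == n, sorted ltn v', all (gtn n) v' & (size v').+1 == c].
  case: c => [|c]; first by rewrite !andbF.
  rewrite -IH; apply/mapP/andP => [[u uI /rcons_inj[-> ->]]|[/eqP -> vI]] //.
  by exists v'.
rewrite sorted_ltn_rcons !all_rcons size_rcons /=.
case: (_ == c); rewrite ?andbF // !andbT.
case: (sorted ltn v'); rewrite ?andbF // ?andbT /=.
case: (ltngtP a n) => [an|na|->] /=; rewrite ?ltnS ?andbF ?orbF.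
- rewrite (ltnW an) /=; case H: (all (gtn a) v') => //=.
  transitivity true; [|symmetry]; apply/allP => y /(allP H) /=; lia.
- by rewrite leqNgt na andbF.
- rewrite leqnn /=; case H: (all (gtn n) v') => //=.
  by symmetry; apply/allP => y /(allP H) /=; lia.
Qed.

Lemma uniq_sublists n c : uniq (sublists n c).
Proof.
elim: n c => [|n IH] [|c] //=; first by rewrite cats0 IH.
rewrite cat_uniq IH map_inj_uniq ?IH ?andbT /=; last by move=> u v /rcons_inj[].
apply/hasPn => v /mapP[u _ ->]; rewrite mem_sublists all_rcons /= ltnn /=.
by rewrite andbF.
Qed.

Lemma size_sublists n c : size (sublists n c) = 'C(n, c).
Proof.
elim: n c => [|n IH] [|c] //=; first by rewrite cats0 IH !bin0.
by rewrite size_cat size_map !IH binS.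
Qed.

Lemma count_sublists n c j i : j <= n -> i <= c ->
  count (fun v => count (gtn j) v == i) (sublists n c) = 'C(j, i) * 'C(n - j, c - i).
Proof.
have full m d : count (fun v => count (gtn m) v == i) (sublists m d) = (d == i) * 'C(m, d).
  rewrite -size_sublists; transitivity (count (fun=> d == i) (sublists m d)).
    apply: eq_in_count => v; rewrite mem_sublists all_count => /and3P[_ /eqP -> /eqP ->].
    by [].
  by case: (d == i); rewrite ?count_predT ?count_pred0 ?mul1n ?mul0n.
elim: n c => [|n IH] c; first by rewrite leqn0 => /eqP -> _; rewrite full !bin0n; lia.
rewrite leq_eqVlt => /orP[/eqP -> ic|].
  rewrite full subnn; case: (eqVneq c i) => [->|ci]; first by rewrite subnn bin0 mul1n muln1.
  by rewrite mul0n bin0n (_ : c - i == 0 = false) ?muln0 //; lia.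
rewrite ltnS => jn ic; rewrite /= count_cat IH //.
case: c ic => [|c] ic; first by move: ic; rewrite leqn0 => /eqP ->; rewrite /= !bin0 addn0.
rewrite count_map (eq_count (a2 := fun v => count (gtn j) v == i)); last first.
  by move=> v /=; rewrite -cats1 count_cat /= ltnNge jn addn0 addn0.
move: ic; rewrite leq_eqVlt => /orP[/eqP ->|].
  rewrite subnn !bin0 (eq_in_count (a2 := pred0)) ?count_pred0 ?addn0 // => v.
  rewrite mem_sublists => /and3P[_ _ /eqP <-] /=.
  by apply/negbTE; rewrite neq_ltn ltnS count_size.
by rewrite ltnS => ic; rewrite IH // subSn // subSn // binS mulnDr.
Qed.

Lemma nth_mem_take (w : seq nat) c i : uniq w -> i < size w ->
  (nth 0 w i \in take c w) = (i < c).
Proof. by move=> uw iw; rewrite in_take ?mem_nth // index_uniq. Qed.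

(** If [x] and [x.+1] are on different sides of the cut, they can be neighbours only across it, and
    that comparison is ignored. Hence the exchange is unconditional here, unlike [swap_values], and
    all sets of [c] values are equally often the left part. *)
Lemma count_cut_sorted n c e v : sorted ltn v -> all (gtn n) v ->
  count (fun w => descents_off c.-1 e w && perm_eq (take c w) v) (perms n) =
  count (fun w => descents_off c.-1 e w && perm_eq (take c w) (iota 0 (size v))) (perms n).
Proof.
move=> sv nv.
pose g v := count (fun w => descents_off c.-1 e w && perm_eq (take c w) v) (perms n).
apply: (@swap_invariant_const nat n g _ v sv nv) => {v sv nv} v x _ nv xv xSv.
have xn : x.+1 < n by exact: (allP nv).
rewrite /g (count_involution _ (uniq_perms n) (f := map (swapS x))); first last.
- by move=> w _; rewrite -map_comp (eq_map (g := id)) ?map_id // => y; rewrite /= swapSK.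
- by move=> w; apply: swapS_perms.
apply: eq_in_count => w wP /=; rewrite -map_take.
have -> : perm_eq (map (swapS x) (take c w)) (map (swapS x) v) = perm_eq (take c w) v.
  by apply/idP/idP => [/perm_map_inj|]; [apply; apply: swapS_inj | apply: perm_map].
case P : (perm_eq _ _); rewrite ?andbF // !andbT.
have uw := perms_uniq_seq wP; have sw := perms_size wP.
have xt : x \notin take c w by rewrite (perm_mem P).
have xSt : x.+1 \in take c w by rewrite (perm_mem P).
have E i : i.+1 < n -> i != c.-1 ->
    (nth 0 (map (swapS x) w) i.+1 < nth 0 (map (swapS x) w) i) = (nth 0 w i.+1 < nth 0 w i).
  move=> im ic; have im' : i < n by exact: ltnW.
  rewrite !(nth_map 0) ?sw //; apply: swapS_lt; apply/negP => /andP[/eqP E1 /eqP E2];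
    move: (nth_mem_take c uw (i := i)) (nth_mem_take c uw (i := i.+1));
    rewrite E1 E2 sw (negbTE xt) xSt => /(_ im') + /(_ im); lia.
apply/(descents_offP _ _ (n := n))/(descents_offP _ _ (n := n)); rewrite ?size_map // => H i im ic.
  by rewrite -E // H.
by rewrite E // H.
Qed.

Lemma count_cut n c e j (T : pred nat) : c <= n ->
  count (fun w => descents_off c.-1 e w && T (count (gtn j) (take c w))) (perms n) =
  count (fun w => descents_off c.-1 e w && perm_eq (take c w) (iota 0 c)) (perms n) *
  count (fun v => T (count (gtn j) v)) (sublists n c).
Proof.
move=> cn; rewrite mulnC.
transitivity (\sum_(v <- sublists n c) \sum_(w <- perms n)
   (T (count (gtn j) v) * (descents_off c.-1 e w && perm_eq (take c w) v))).
  rewrite exchange_big /= -sum1_count big_mkcond; apply: eq_big_seq => w wP.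
  have [v0 vI vE] : exists2 v0, v0 \in sublists n c &
      forall v, v \in sublists n c -> perm_eq (take c w) v = (v == v0).
    have ut : uniq (take c w) by exact: take_uniq (perms_uniq_seq wP).
    have p0 : perm_eq (sort leq (take c w)) (take c w) by rewrite perm_sort.
    have s0 : sorted ltn (sort leq (take c w)).
      by rewrite ltn_sorted_uniq_leq sort_uniq ut sort_sorted //; exact: leq_total.
    exists (sort leq (take c w)).
      rewrite mem_sublists s0 size_sort size_takel ?(perms_size wP) // eqxx andbT.
      apply/allP => y; rewrite mem_sort => /mem_take.
      by rewrite (perms_mem _ wP).
    move=> v; rewrite mem_sublists => /and3P[sv _ _]; apply/idP/eqP => [P|->].
      apply: (irr_sorted_eq ltn_trans ltnn sv s0) => y.
      by rewrite (perm_mem p0) (perm_mem P).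
    by rewrite perm_sym.
  have p0 : perm_eq (take c w) v0 by rewrite vE.
  rewrite (bigD1_seq v0) ?uniq_sublists //= p0 andbT (seq.permP p0) big1_seq.
    by rewrite addn0; case: T; case: descents_off.
  by move=> v /andP[v0' vI']; rewrite vE // (negbTE v0') andbF muln0.
rewrite -sum1_count big_distrl /= [RHS]big_mkcond; apply: eq_big_seq => v.
rewrite mem_sublists => /and3P[sv nv /eqP sc].
rewrite -big_distrr /=; case: T => //; rewrite !mul1n.
have := count_cut_sorted c e sv nv; rewrite sc => <-.
by rewrite -sum1_count [RHS]big_mkcond.
Qed.

Definition to_end (b : bool) (n a y : nat) : nat :=
  if b then (if y == a then n.-1 else if a < y then y.-1 else y)
  else (if y == a then 0 else if y < a then y.+1 else y).

Lemma to_end_inj b n a : a < n -> {in gtn n &, injective (to_end b n a)}.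
Proof.
by move=> an y z; rewrite !inE /to_end => yn zn; case: b;
  do 2 ?[case: eqP => ?]; do 2 ?[case: ltnP => ?]; lia.
Qed.

Lemma to_end_lt b n a y : a < n -> y < n -> to_end b n a y < n.
Proof.
rewrite /to_end => an yn; case: b; case: (y =P a) => ?; try lia.
  by case: (ltnP a y) => ?; lia.
by case: (ltnP y a) => ?; lia.
Qed.

Lemma to_end_mono b n a y z : y != a -> z != a ->
  (to_end b n a y < to_end b n a z) = (y < z).
Proof.
move=> /negbTE ya /negbTE za; rewrite /to_end ya za.
case: b; first by case: (ltnP a y) => ?; case: (ltnP a z) => ?; lia.
by case: (ltnP y a) => ?; case: (ltnP z a) => ?; lia.
Qed.

Lemma to_end_lt_end b n a y : y < n -> a < n -> y != a ->
  (to_end b n a y < to_end b n a a) = b.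
Proof.
move=> yn an /negbTE ya; rewrite /to_end ya eqxx.
case: b; first by case: (ltnP a y) => ?; lia.
by case: (ltnP y a) => ?; lia.
Qed.

Lemma to_end_gt_end b n a y : y < n -> a < n -> y != a ->
  (to_end b n a a < to_end b n a y) = ~~ b.
Proof.
move=> yn an /negbTE ya; rewrite /to_end ya eqxx.
case: b; first by case: (ltnP a y) => ?; lia.
by case: (ltnP y a) => ?; lia.
Qed.

(* Moving the entry before the cut to the lowest or highest value restores the
   descent at the cut, at the price of forgetting that entry. *)
Lemma count_descents_off n c e : 1 < c < n -> size e = n.-1 ->
  nth false e c.-2 != nth false e c.-1 ->
  count (descents_off c.-1 e) (perms n) <=
  n * count (fun w => descents w == e) (perms n).
Proof.
move=> /andP[c1 cn] se ec.
set b := nth false e c.-1.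
pose F w := (map (to_end b n (nth 0 w c.-1)) w, nth 0 w c.-1).
rewrite mulnC -[X in _ <= _ * X](size_iota 0 n) -!size_filter -(size_allpairs pair) -(size_map F).
apply: uniq_leq_size.
  rewrite map_inj_in_uniq ?filter_uniq ?uniq_perms // => w w'.
  rewrite !mem_filter => /andP[_ wP] /andP[_ wP'] [+ E].
  rewrite -E; have an : nth 0 w c.-1 < n.
    by rewrite -(perms_mem _ wP) mem_nth // (perms_size wP); lia.
  by apply: (inj_in_map (to_end_inj an)); apply/allP => y; rewrite (perms_mem _ wP, perms_mem _ wP').
move=> _ /mapP[w + ->]; rewrite mem_filter => /andP[dw wP]; rewrite /F.
have sw := perms_size wP; have uw := perms_uniq_seq wP.
set a := nth 0 w c.-1.
have an : a < n by rewrite -(perms_mem _ wP) mem_nth // sw; lia.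
apply/allpairsP; exists (map (to_end b n a) w, a); split => //; last by rewrite mem_iota.
rewrite mem_filter map_perms //; last 2 first.
- exact: to_end_inj.
- by move=> y; apply: to_end_lt.
rewrite andbT; apply/(eq_descents (n := n)); rewrite ?size_map // => i im.
have im' : i < n by exact: ltnW.
have na k : k < n -> (nth 0 w k == a) = (k == c.-1).
  by move=> kn; rewrite nth_uniq ?sw //; lia.
have nn k : k < n -> nth 0 w k < n.
  by move=> kn; rewrite -(perms_mem _ wP) mem_nth ?sw.
rewrite !(nth_map 0) ?sw //.
(* The moved entry takes part in the comparisons [c.-1] and [c.-2]. At the extreme value it gives
   them the signs [b] and [~~ b], which are those of [e] because [e] changes sign there. *)
case: (eqVneq i c.-1) => [E|i1].
  have -> : nth 0 w i = a by rewrite E.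
  rewrite to_end_lt_end ?nn ?na // ?E //; lia.
case: (eqVneq i c.-2) => [E|i2].
  have -> : nth 0 w i.+1 = a by rewrite E /a; congr (nth _ _ _); lia.
  rewrite to_end_gt_end ?nn ?na // ?E; lia.
rewrite to_end_mono ?na //; last by lia.
exact: (descents_offP _ _ sw dw).
Qed.

(** Permutations with the exact signs are at least a share [1 / n] of those with the sign at the cut
    ignored, and for the latter the left part is a uniform [c]-subset. So an event about the left
    part is at most [n] times as likely as for a uniform subset; products replace quotients to stay
    in [nat]. *)
Lemma count_turning n c e j (T : pred nat) : 1 < c < n -> size e = n.-1 ->
  nth false e c.-2 != nth false e c.-1 ->
  count (fun w => (descents w == e) && T (count (gtn j) (take c w))) (perms n) * 'C(n, c) <=
  n * count (fun w => descents w == e) (perms n) *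
  count (fun v => T (count (gtn j) v)) (sublists n c).
Proof.
move=> cc se ec; have cn : c <= n by lia.
have H := count_descents_off cc se ec.
have := count_cut e j predT cn; rewrite (eq_count (a2 := descents_off c.-1 e)); last by move=> w /=; rewrite andbT.
rewrite [count _ (sublists _ _)](_ : _ = 'C(n, c)); last by rewrite count_predT size_sublists.
set g := (X in _ = X * _ -> _) => E.
apply: (@leq_trans (g * count (fun v => T (count (gtn j) v)) (sublists n c) * 'C(n, c))).
  rewrite leq_mul2r -(count_cut e j T cn); apply/orP; right.
  rewrite -!size_filter; apply: uniq_leq_size; first by rewrite filter_uniq // uniq_perms.
  move=> w; rewrite !mem_filter => /andP[/andP[dw ->] wP]; rewrite wP !andbT.
  apply/(descents_offP _ _ (perms_size wP)) => i im _.
  by have /(eq_descents (perms_size wP) se) := dw; apply.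
by rewrite mulnAC -E leq_mul2r H orbT.
Qed.

(** * Hypergeometric tails *)

Section Tail.
Variable R : realFieldType.
Local Open Scope ring_scope.

(** The ratio of consecutive hypergeometric weights is [(j - i) (c - i) / ((i + 1) (n - j - c + i +
    1))], and the denominator exceeds the numerator by at least [i n - c j]. Since [i] is at least
    [d n] above the mean [c j / n], this excess is at least [d n ^ 2], hence at least a share [d] of
    the denominator, which is at most [n ^ 2]. *)
Lemma hypergeometric_ratio (n c j i : nat) (d : R) : (j <= n)%N -> (c <= n)%N ->
  (i < c)%N -> 0 < d <= 1 -> (0 < n)%N ->
  c%:R * j%:R + d * n%:R ^+ 2 <= i%:R * n%:R ->
  ('C(j, i.+1) * 'C(n - j, c - i.+1))%:R <=
    (1 - d) * ('C(j, i) * 'C(n - j, c - i))%:R :> R.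
Proof.
move=> jn cn ic /andP[d0 d1] n0 hi.
have r0 : 0 <= (1 - d) * ('C(j, i) * 'C(n - j, c - i))%:R.
  by rewrite mulr_ge0 ?subr_ge0.
case: (leqP j i) => [ji|ij]; first by rewrite bin_small // mul0n.
case: (ltnP (n - j) (c - i.+1)) => [Nm|mN]; first by rewrite [X in (_ * X)%N]bin_small // muln0.
have E : ('C(j, i.+1) * 'C(n - j, c - i.+1) * (i.+1 * (n - j - (c - i.+1))) =
          'C(j, i) * 'C(n - j, c - i) * ((j - i) * (c - i)))%N.
  have := mul_bin_left j i; have := mul_bin_left (n - j) (c - i.+1).
  rewrite subnSK // => E1 E2.
  transitivity ((i.+1 * 'C(j, i.+1)) * ((n - j - (c - i.+1)) * 'C(n - j, c - i.+1)))%N; first by ring.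
  by rewrite E2 -E1; ring.
have E' : ('C(j, i.+1) * 'C(n - j, c - i.+1))%:R * (i.+1%:R * (n%:R - j%:R - c%:R + i%:R + 1)) =
   ('C(j, i) * 'C(n - j, c - i))%:R * ((j%:R - i%:R) * (c%:R - i%:R)) :> R.
  have := congr1 (fun k : nat => k%:R : R) E; rewrite !(natrM _ (_ * _)%N) (natrM _ i.+1) (natrM _ (j - i)).
  rewrite (natrB _ mN) (natrB _ jn) (natrB _ ic) (natrB _ (ltnW ij)) (natrB _ (ltnW ic)) => {}E.
  rewrite -E -natr1; ring.
move: E' r0 hi => {E}; set h' := ('C(j, i.+1) * _)%:R; set h := ('C(j, i) * _)%:R.
have h0 : 0 <= h by [].
have : (i.+1%:R <= j%:R :> R) by rewrite ler_nat.
have : (i.+1%:R <= c%:R :> R) by rewrite ler_nat.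
have : (j%:R <= n%:R :> R) by rewrite ler_nat.
have : (c%:R <= n%:R :> R) by rewrite ler_nat.
have : (0 <= i%:R :> R) by [].
have : (0 < n%:R :> R) by rewrite ltr0n.
rewrite -natr1; move: (i%:R) (j%:R) (c%:R) (n%:R) => I J C N N0 I0 CN JN IC IJ E r0 hi.
have dN : 0 < d * N ^+ 2 by rewrite mulr_gt0 // exprn_gt0.
set D := (I + 1) * (N - J - C + I + 1) in E *.
have B0 : 0 < I * (N - J - C + I).
  have : I * (N - J - C + I) = I * N - C * J + (J - I) * (C - I) by ring.
  have : 0 <= (J - I) * (C - I) by apply: mulr_ge0; lra.
  lra.
have B1 : 0 < N - J - C + I.
  rewrite ltNge; apply/negP => H; have : I * (N - J - C + I) <= 0 by rewrite mulr_ge0_le0.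
  lra.
have D0 : 0 < D by apply: mulr_gt0; lra.
have DN : D <= N ^+ 2 by rewrite expr2; apply: ler_pM; lra.
rewrite -(ler_pM2r D0) E [leRHS](_ : _ = h * ((1 - d) * D)); last by ring.
apply: ler_wpM2l => //.
have : d * D <= d * N ^+ 2 by rewrite ler_pM2l.
have : D = (J - I) * (C - I) + (I * N - C * J) + (I + (N - J - C + I) + 1) by rewrite /D; ring.
lra.
Qed.

Lemma bin_mul_le (n c j i : nat) : (j <= n)%N -> (i <= c)%N ->
  ('C(j, i) * 'C(n - j, c - i) <= 'C(n, c))%N.
Proof. by move=> jn ic; rewrite -count_sublists // -size_sublists count_size. Qed.

(** Going down from [i], each of [t] steps gains a factor [1 - d]. The distance [2 d n] from the
    mean is chosen so that after at most [d n] steps the index is still [d n] above it, as the ratio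
    bound requires. *)
Lemma hypergeometric_upper (n c j i t : nat) (d : R) : (j <= n)%N -> (c <= n)%N ->
  (i <= c)%N -> 0 < d <= 1 -> (0 < n)%N -> t%:R <= d * n%:R ->
  c%:R * j%:R + 2 * d * n%:R ^+ 2 <= i%:R * n%:R ->
  ('C(j, i) * 'C(n - j, c - i))%:R <= (1 - d) ^+ t * 'C(n, c)%:R :> R.
Proof.
move=> jn cn ic d01 n0 td hi.
have n0' : 0 < n%:R :> R by rewrite ltr0n.
have H s : (s <= t)%N -> (s <= i)%N /\
    ('C(j, i) * 'C(n - j, c - i))%:R <=
    (1 - d) ^+ s * ('C(j, i - s) * 'C(n - j, c - (i - s)))%:R :> R.
  elim: s => [|s IH] st; first by rewrite subn0 expr0 mul1r.
  have [si IHs] := IH (ltnW st).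
  have st' : s.+1%:R <= d * n%:R by apply: le_trans td; rewrite ler_nat.
  have B : d * n%:R ^+ 2 + s.+1%:R * n%:R <= i%:R * n%:R.
    have : s.+1%:R * n%:R <= d * n%:R * n%:R by rewrite ler_pM2r.
    have : 0 <= c%:R * j%:R :> R by rewrite mulr_ge0.
    move: hi; rewrite expr2; lra.
  have si' : (s < i)%N.
    rewrite -(ltr_nat R) -(ltr_pM2r n0') in si *; move: B; rewrite -natr1.
    have : 0 < d * n%:R ^+ 2 by rewrite mulr_gt0 ?exprn_gt0 //; lra.
    lra.
  split => //; apply: (le_trans IHs); rewrite exprSr -mulrA ler_wpM2l //.
    by rewrite exprn_ge0 // subr_ge0; lra.
  have := @hypergeometric_ratio n c j (i - s.+1) d jn cn _ d01 n0.
  rewrite subnSK //; apply; first by lia.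
  rewrite natrB // mulrBl.
  have : s.+1%:R * n%:R <= d * n%:R * n%:R by rewrite ler_pM2r.
  move: hi; rewrite expr2; lra.
have [ti /le_trans] := H t (leqnn t); apply.
rewrite ler_wpM2l ?exprn_ge0 ?subr_ge0 ?ler_nat //; first by case/andP: d01.
by apply: bin_mul_le => //; lia.
Qed.

Lemma hypergeometric_tail (n c j i t : nat) (d : R) : (j <= n)%N -> (c <= n)%N ->
  (i <= c)%N -> 0 < d <= 1 -> (0 < n)%N -> t%:R <= d * n%:R ->
  2 * d * n%:R ^+ 2 <= `|i%:R * n%:R - c%:R * j%:R| ->
  ('C(j, i) * 'C(n - j, c - i))%:R <= (1 - d) ^+ t * 'C(n, c)%:R :> R.
Proof.
move=> jn cn ic d01 n0 td; rewrite ler_normr => /orP[H|H].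
  by apply: hypergeometric_upper => //; lra.
(* The lower tail is the upper tail for the values not below [j]: there are [n - j] of them, [c - i]
   in the subset. *)
have := @hypergeometric_upper n c (n - j) (c - i) t d; rewrite subKn // subKn // mulnC.
apply=> //; try lia.
by rewrite !natrB //; lra.
Qed.

Lemma count_sublists_tail (n c j t : nat) (d : R) : (j <= n)%N -> (c <= n)%N ->
  0 < d <= 1 -> (0 < n)%N -> t%:R <= d * n%:R ->
  (count (fun v : seq nat => 2 * d * n%:R ^+ 2 <=
      `|(count (gtn j) v)%:R * n%:R - c%:R * j%:R|) (sublists n c))%:R
  <= n.+1%:R * (1 - d) ^+ t * 'C(n, c)%:R :> R.
Proof.
move=> jn cn d01 n0 td.
pose T (i : nat) := 2 * d * n%:R ^+ 2 <= `|i%:R * n%:R - c%:R * j%:R|.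
rewrite -/(count (fun v => T (count (gtn j) v)) (sublists n c)).
have -> : count (fun v => T (count (gtn j) v)) (sublists n c) =
    (\sum_(i < c.+1 | T i) count (fun v => count (gtn j) v == i) (sublists n c))%N.
  under eq_bigr do rewrite -sum1_count big_mkcond.
  rewrite exchange_big /= -sum1_count big_mkcond; apply: eq_big_seq => v.
  rewrite mem_sublists => /and3P[_ _ /eqP sv].
  have vc : (count (gtn j) v < c.+1)%N by rewrite ltnS -sv count_size.
  rewrite big_mkcond (bigD1 (Ordinal vc)) //= eqxx big1 ?addn0 //.
  by move=> i; rewrite -val_eqE /= eq_sym => /negbTE ->; case: ifP.
rewrite natr_sum; apply: (@le_trans _ _ (\sum_(i < c.+1) (1 - d) ^+ t * 'C(n, c)%:R)).
  rewrite big_mkcond /=; apply: ler_sum => i _.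
  have B0 : 0 <= (1 - d) ^+ t * 'C(n, c)%:R :> R.
    by rewrite mulr_ge0 // exprn_ge0 // subr_ge0; case/andP: d01.
  case: ifP => // Ti; rewrite count_sublists //; last by rewrite -ltnS.
  by apply: hypergeometric_tail; rewrite // -ltnS.
rewrite sumr_const card_ord -[X in X <= _]mulr_natl -mulrA ler_wpM2r ?ler_nat ?ltnS //.
by rewrite mulr_ge0 // exprn_ge0 // subr_ge0; case/andP: d01.
Qed.

(** In the third case the signs [c.-2] and [c.-1] are the two comparisons of the entry at [c.-1],
    the last one left of the cut, which is thus a local extremum. For [0] and [n] the left part is
    empty or everything. *)
Definition cut_point (n : nat) (e : seq bool) (c : nat) : bool :=
  [|| c == 0, c == n | (1 < c < n)%N && (nth false e c.-2 != nth false e c.-1)]%N.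

(** The factor [n] stems from the ignored sign, [n.+1] from the possible values of the count; for
    the cuts [0] and [n] the deviation vanishes. *)
Lemma cut_point_concentration (n c j t : nat) (e : seq bool) (d : R) :
  (j <= n)%N -> cut_point n e c -> size e = n.-1 -> 0 < d <= 1 -> (0 < n)%N ->
  t%:R <= d * n%:R ->
  (count (fun w => (descents w == e) &&
     (2 * d * n%:R ^+ 2 <= `|(count (gtn j) (take c w))%:R * n%:R - c%:R * j%:R|)) (perms n))%:R
  <= n%:R * n.+1%:R * (1 - d) ^+ t * (count (fun w => descents w == e) (perms n))%:R :> R.
Proof.
move=> jn cp se d01 n0 td.
have d0 : 0 < 2 * d * n%:R ^+ 2 by rewrite mulr_gt0 ?exprn_gt0 ?ltr0n //; lra.
have B0 : 0 <= n%:R * n.+1%:R * (1 - d) ^+ t * (count (fun w => descents w == e) (perms n))%:R :> R.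
  by rewrite !mulr_ge0 // exprn_ge0 // subr_ge0; case/andP: d01.
have zero : (forall w, w \in perms n -> (count (gtn j) (take c w))%:R * n%:R = c%:R * j%:R :> R) ->
    count (fun w => (descents w == e) &&
     (2 * d * n%:R ^+ 2 <= `|(count (gtn j) (take c w))%:R * n%:R - c%:R * j%:R|)) (perms n) = 0%N.
  move=> H; rewrite (eq_in_count (a2 := pred0)) ?count_pred0 // => w wP /=.
  by rewrite H // subrr normr0 leNgt d0 andbF.
case/or3P: cp => [/eqP c0|/eqP cn|/andP[cc ec]].
- by rewrite zero // => w _; rewrite c0 take0 !mul0r.
- rewrite zero // => w wP; rewrite cn -(perms_size wP) take_size (perms_size wP) mulrC.
  congr (_ * _%:R); move: wP; rewrite mem_perms => /seq.permP ->.
  rewrite -{1}(subnKC jn) iotaD count_cat (_ : count _ (iota _ (n - j)) = 0%N) ?addn0.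
    apply/eqP; rewrite -[X in _ == X](size_iota 0 j) -all_count.
    by apply/allP => y; rewrite mem_iota.
  by apply/eqP; rewrite -leqn0 leqNgt -has_count; apply/hasPn => y; rewrite mem_iota /= -leqNgt => /andP[].
have C0 : 0 < 'C(n, c)%:R :> R by rewrite ltr0n bin_gt0; lia.
have := count_turning j (fun i : nat => 2 * d * n%:R ^+ 2 <= `|i%:R * n%:R - c%:R * j%:R|) cc se ec.
rewrite -(ler_nat R) !natrM => H; rewrite -(ler_pM2r C0); apply: (le_trans H).
have cn : (c <= n)%N by lia.
have := count_sublists_tail jn cn d01 n0 td.
move=> /(ler_wpM2l (_ : 0 <= n%:R * (count (fun w => descents w == e) (perms n))%:R)).
move=> /(_ (mulr_ge0 (ler0n _ _) (ler0n _ _))) /le_trans; apply.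
by rewrite le_eqVlt; apply/orP; left; apply/eqP; ring.
Qed.
End Tail.

(** * Weighted sums over cells *)

Section WeightedSum.
Variables (R : realFieldType) (C : finType).
Local Open Scope ring_scope.
Implicit Types (l : nat -> C -> R) (h : seq C -> R).

(** The expectation of [h] at [k] independent cells, the [i]-th drawn with weights [l i]. The
    recursion follows those of [block_avg] and [iter_int01], the two quantities that are compared
    through it. *)
Fixpoint wsum k l h : R :=
  if k is k'.+1 then
    \sum_(a : C) l 0%N a * wsum k' (fun i => l i.+1) (fun s => h (a :: s))
  else h [::].

Definition subprob l := forall i, (forall a, 0 <= l i a) /\ \sum_a l i a <= 1.

Lemma subprobS l : subprob l -> subprob (fun i => l i.+1).
Proof. by move=> pl i. Qed.

Lemma wsum_le k l h h' : subprob l -> (forall s, size s = k -> h s <= h' s) ->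
  wsum k l h <= wsum k l h'.
Proof.
elim: k l h h' => [|k IH] l h h' pl hh /=; first exact: hh.
apply: ler_sum => a _; apply: ler_wpM2l; first by have [] := pl 0%N.
by apply: IH => [|s sk]; [exact: subprobS | apply: hh; rewrite /= sk].
Qed.

Lemma wsumD k l h h' : wsum k l (fun s => h s + h' s) = wsum k l h + wsum k l h'.
Proof.
elim: k l h h' => [//|k IH] l h h' /=; rewrite -big_split /=.
by apply: eq_bigr => a _; rewrite IH mulrDr.
Qed.

Lemma wsum_cst k l (x : R) : subprob l -> 0 <= x -> 0 <= wsum k l (fun=> x) <= x.
Proof.
move=> + x0; elim: k l => [|k IH] l pl /=; first by rewrite x0 lexx.
have [l0 l1] := pl 0%N; have /andP[I0 I1] := IH _ (subprobS pl).
rewrite -mulr_suml; apply/andP; split.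
  by rewrite mulr_ge0 // sumr_ge0.
by apply: (le_trans (ler_wpM2r I0 l1)); rewrite mul1r.
Qed.

Lemma wsum01 k l h : subprob l -> (forall s, 0 <= h s <= 1) -> 0 <= wsum k l h <= 1.
Proof.
move=> pl h01; apply/andP; split.
  have /andP[+ _] := wsum_cst k pl (lexx 0); move=> /le_trans; apply.
  by apply: wsum_le => // s _; case/andP: (h01 s).
have /andP[_] := wsum_cst k pl ler01; apply: le_trans.
by apply: wsum_le => // s _; case/andP: (h01 s).
Qed.

Lemma wsum_close k l l' h (th : R) : subprob l -> subprob l' ->
  (forall s, 0 <= h s <= 1) -> 0 <= th ->
  (forall i a, (i < k)%N -> `|l i a - l' i a| <= th) ->
  `|wsum k l h - wsum k l' h| <= k%:R * #|C|%:R * th.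
Proof.
move=> + + + th0; elim: k l l' h => [|k IH] l l' h pl pl' h01 ll /=.
  by rewrite subrr normr0 !mul0r.
rewrite -sumrB.
have pS := subprobS pl; have pS' := subprobS pl'.
apply: (@le_trans _ _ (\sum_(a : C) (th + l' 0%N a * (k%:R * #|C|%:R * th)))).
  apply: (le_trans (ler_norm_sum _ _ _)); apply: ler_sum => a _.
  set A := wsum k _ _; set B := wsum k _ _.
  have AB : `|A - B| <= k%:R * #|C|%:R * th.
    by apply: IH => // i b ik; apply: ll.
  have /andP[A0 A1] : 0 <= A <= 1 by apply: wsum01.
  rewrite (_ : _ - _ = (l 0%N a - l' 0%N a) * A + l' 0%N a * (A - B)); last by ring.
  apply: (le_trans (ler_normD _ _)); rewrite !normrM lerD //.
    by rewrite -[leRHS]mulr1; apply: ler_pM => //; [apply: ll | rewrite ger0_norm].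
  by rewrite (ger0_norm ((pl' 0%N).1 a)) ler_wpM2l //; exact: (pl' 0%N).1.
rewrite big_split /= sumr_const -mulr_suml -[th *+ _]mulr_natl -natr1 !mulrDl mul1r [leRHS]addrC.
rewrite lerD2l -[leRHS]mul1r ler_wpM2r ?mulr_ge0 //; exact: (pl' 0%N).2.
Qed.

Lemma wsum_mem k (l : C -> R) a : (forall b, 0 <= l b) -> \sum_b l b <= 1 ->
  wsum k (fun=> l) (fun s => (a \in s)%:R) <= k%:R * l a.
Proof.
move=> l0 l1; have pl : subprob (fun=> l) by move=> i.
elim: k => [|k IH] /=; first by rewrite mul0r.
apply: (@le_trans _ _ (\sum_b ((b == a)%:R * l b + l b * (k%:R * l a)))).
  apply: ler_sum => b _.
  apply: (@le_trans _ _ (l b * (wsum k (fun=> l) (fun=> (b == a)%:R) +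
      wsum k (fun=> l) (fun s => (a \in s)%:R)))).
    rewrite ler_wpM2l // -wsumD; apply: wsum_le => // s _.
    by rewrite inE eq_sym; case: (_ == _); case: (_ \in _); rewrite /= ?addr0 ?add0r ?lerDl.
  rewrite mulrDr; apply: lerD; last by rewrite ler_wpM2l.
  rewrite mulrC ler_wpM2r //.
  by have /andP[] := wsum_cst k pl (ler0n _ (b == a)).
rewrite big_split /= -mulr_suml -natr1 mulrDl addrC mul1r lerD //.
  by rewrite -[leRHS]mul1r ler_wpM2r // mulr_ge0.
rewrite (bigD1 a) //= eqxx mul1r big1 ?addr0 // => b /negbTE ->; exact: mul0r.
Qed.

End WeightedSum.

Section Cells.
Variables (N : nat) (ty : 'I_N -> option bool).
Implicit Types (al : seq (option 'I_N)).

(* [None] is the junk cell; [ty a] is [Some false] on ascending runs, [Some true]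
   on descending runs and [None] on short cells. *)
Definition crowded (a : option 'I_N) al : bool :=
  if a is Some b then (ty b == None) && (a \in al) else true.

Fixpoint uncrowded al : bool :=
  if al is a :: al' then ~~ crowded a al' && uncrowded al' else true.

(** The paintbox rule read on cells: does value [i] stand left of value [j]? For junk and within a
    short cell [false] is a mere default for distinct values, since [uncrowded] excludes both
    situations. *)
Definition precedes al (i j : nat) : bool :=
  match nth None al i, nth None al j with
  | Some a, Some b => (a < b) || (a == b) &&
      (match ty a with Some false => i < j | Some true => j < i | None => false end)
  | _, _ => false
  end.

Definition realizes (sg : seq nat) al : bool :=
  all (fun i => all (fun j => (index i sg < index j sg) == precedes al i j)
                    (iota 0 (size sg))) (iota 0 (size sg)).

Lemma realizesP sg al :
  reflect (forall i j, i < size sg -> j < size sg ->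
             (index i sg < index j sg) = precedes al i j) (realizes sg al).
Proof.
apply: (iffP allP) => [H i j ik jk|H i].
  have /H/allP : i \in iota 0 (size sg) by rewrite mem_iota.
  by move=> /(_ j); rewrite mem_iota => /(_ jk)/eqP.
by rewrite mem_iota => ik; apply/allP => j; rewrite mem_iota => jk; apply/eqP/H.
Qed.

Lemma uncrowded_nth al i : uncrowded al -> i < size al -> nth None al i != None.
Proof.
elim: al i => [//|a al IH] [|i] /= /andP[ca sa] il; last exact: IH.
by case: a ca.
Qed.

Lemma uncrowded_neq al i j a : uncrowded al -> i < size al -> j < size al -> i != j ->
  nth None al i = Some a -> nth None al j = Some a -> ty a != None.
Proof.
have lt al' i' j' : uncrowded al' -> i' < j' < size al' ->
    nth None al' i' = Some a -> nth None al' j' = Some a -> ty a != None.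
  elim: al' i' j' => [|b al' IH] i' j'; first by rewrite andbF.
  case: j' => [|j'] //= /andP[ca sa]; rewrite !ltnS; case: i' => [|i'] /=.
    move=> jl bE jE; move: ca; rewrite bE /= negb_and => /orP[//|].
    by rewrite -jE mem_nth.
  exact: IH.
move=> sa il jl; case: (ltngtP i j) => // [ij|ji] _ iE jE.
  by apply: (lt al i j) => //; rewrite ij.
by apply: (lt al j i) => //; rewrite ji.
Qed.

Variable R : realFieldType.
Local Open Scope ring_scope.

(** Configurations that are not [uncrowded] leave the order undecided; [lower_ind] counts them as
    failures and [upper_ind] as successes, so that the same two functions enclose the pattern count
    and the paintbox probability. *)
Definition lower_ind sg al : R := (uncrowded al && realizes sg al)%:R.
Definition upper_ind sg al : R := (~~ uncrowded al || realizes sg al)%:R.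

Lemma lower_ind01 sg al : 0 <= lower_ind sg al <= 1.
Proof. by rewrite /lower_ind ler0n -[1]/(1%:R) ler_nat leq_b1. Qed.

Lemma upper_ind01 sg al : 0 <= upper_ind sg al <= 1.
Proof. by rewrite /upper_ind ler0n -[1]/(1%:R) ler_nat leq_b1. Qed.

(** The two sums differ only where cells are crowded. A new cell is short and hit again by one of
    [j] others with probability at most [j d], and these bounds add up to at most [k ^ 2 d]. *)
Lemma wsum_upper_lower k sg (l : option 'I_N -> R) (d : R) :
  (forall a, 0 <= l a) -> \sum_a l a <= 1 -> l None = 0 -> 0 <= d ->
  (forall a, ty a = None -> l (Some a) <= d) ->
  wsum k (fun=> l) (upper_ind sg) <= wsum k (fun=> l) (lower_ind sg) + k%:R ^+ 2 * d.
Proof.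
move=> l0 l1 lN d0 ld; have pl : subprob (fun=> l) by move=> i.
have bad j : wsum j (fun=> l) (fun al => (~~ uncrowded al)%:R) <= j%:R ^+ 2 * d.
  elim: j => [|j IH] /=; first by rewrite expr0n mul0r.
  apply: (@le_trans _ _ (\sum_a l a * (j%:R * d + j%:R ^+ 2 * d))); last first.
    rewrite -mulr_suml; apply: (@le_trans _ _ (1 * (j%:R * d + j%:R ^+ 2 * d))).
      by rewrite ler_wpM2r // addr_ge0 // mulr_ge0 // exprn_ge0.
    rewrite mul1r -mulrDl ler_wpM2r // -natr1 sqrrD expr1n mulr1.
    have : 0 <= j%:R :> R by []. 
    lra.
  apply: ler_sum => -[a|] _; last by rewrite lN !mul0r.
  rewrite ler_wpM2l //.
  apply: (@le_trans _ _ (wsum j (fun=> l) (fun al => (crowded (Some a) al)%:R) +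
      wsum j (fun=> l) (fun al => (~~ uncrowded al)%:R))).
    rewrite -wsumD; apply: wsum_le => // s _.
    by rewrite negb_and negbK; case: crowded; case: uncrowded; rewrite /= ?addr0 ?add0r ?lerDl.
  apply: lerD => //=; case: (eqVneq (ty a) None) => [aN|_].
    apply: (@le_trans _ _ (j%:R * l (Some a))); first exact: wsum_mem.
    by rewrite ler_wpM2l ?ld.
  have /andP[_ H] := wsum_cst j pl (lexx 0).
  apply: (@le_trans _ _ 0); last by rewrite mulr_ge0.
  exact: H.
apply: (le_trans _ (lerD (lexx _) (bad k))); rewrite -wsumD; apply: wsum_le => // s _.
by rewrite /upper_ind /lower_ind; case: uncrowded; case: realizes; rewrite /= ?addr0 ?add0r.
Qed.

End Cells.

(** * Comparison of patterns with cells *)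

Section Averages.
Variable R : realFieldType.
Local Open Scope ring_scope.

Fixpoint block_avg (m k i0 : nat) (phi : seq nat -> R) : R :=
  if k is k'.+1 then
    m%:R^-1 * \sum_(u < m) block_avg m k' i0.+1 (fun s => phi ((i0 * m + u)%N :: s))
  else phi [::].

Definition in_blocks (m i0 : nat) (v : seq nat) :=
  forall i, (i < size v)%N -> ((i0 + i) * m <= nth 0 v i < (i0 + i).+1 * m)%N.

Lemma block_avg_le m k i0 phi psi :
  (forall v, size v = k -> in_blocks m i0 v -> phi v <= psi v) ->
  block_avg m k i0 phi <= block_avg m k i0 psi.
Proof.
elim: k i0 phi psi => [|k IH] i0 phi psi H /=; first exact: H.
rewrite ler_wpM2l ?invr_ge0 //; apply: ler_sum => u _.
apply: IH => s sk bs; apply: H => [|[|i]] /=; first by rewrite sk.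
  by move=> _; rewrite addn0 leq_addr mulSn addnC ltn_add2r ltn_ord.
by rewrite ltnS => /bs; rewrite addSnnS.
Qed.

Lemma block_avg_sum (T : Type) (s : seq T) (P : pred T) m k i0 (F : T -> seq nat -> R) :
  block_avg m k i0 (fun v => \sum_(w <- s | P w) F w v) =
  \sum_(w <- s | P w) block_avg m k i0 (F w).
Proof.
elim: k i0 F => [//|k IH] i0 F /=.
under eq_bigr do rewrite IH.
by rewrite exchange_big /= mulr_sumr.
Qed.

Lemma block_avg_cst m k i0 (x : R) : (0 < m)%N -> block_avg m k i0 (fun=> x) = x.
Proof.
move=> m0; elim: k i0 => [//|k IH] i0 /=.
under eq_bigr do rewrite IH.
by rewrite sumr_const card_ord -[x *+ _]mulr_natl mulKf // pnatr_eq0 -lt0n.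
Qed.

Definition block_freq (C : finType) (m : nat) (cell : nat -> C) (i : nat) (a : C) : R :=
  m%:R^-1 * \sum_(u < m) (cell (i * m + u)%N == a)%:R.

(** The source of independence: values are chosen independently from different blocks, so for a
    fixed permutation their cells have a product law, whatever the permutation is. *)
Lemma block_avg_cells (C : finType) m k i0 (cell : nat -> C) (h : seq C -> R) :
  block_avg m k i0 (fun v => h (map cell v)) =
  wsum k (fun i => block_freq m cell (i0 + i)) h.
Proof.
elim: k i0 h => [//|k IH] i0 h /=.
transitivity (m%:R^-1 * \sum_(u < m) \sum_a
   (cell (i0 * m + u)%N == a)%:R * wsum k (fun i => block_freq m cell (i0.+1 + i)) (fun s => h (a :: s))).
  congr (_ * _); apply: eq_bigr => u _.
  rewrite (IH i0.+1 (fun s => h (cell (i0 * m + u)%N :: s))).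
  rewrite (bigD1 (cell (i0 * m + u)%N)) //= eqxx mul1r big1 ?addr0 // => a.
  by rewrite eq_sym => /negbTE ->; rewrite mul0r.
rewrite exchange_big /= mulr_sumr; apply: eq_bigr => a _.
rewrite /block_freq addn0 -mulr_suml mulrA; congr (_ * _).
by congr wsum; apply/funext => i; rewrite addSnnS.
Qed.

Lemma subprob_block_freq (C : finType) m (cell : nat -> C) :
  subprob (fun i => block_freq m cell (0 + i)).
Proof.
move=> i; split=> [a|]; first by rewrite mulr_ge0 ?invr_ge0 // sumr_ge0.
rewrite /block_freq -mulr_sumr exchange_big /=.
under eq_bigr => u _.
  rewrite (bigD1 (cell ((0 + i) * m + u)%N)) //= eqxx big1 ?addr0; last first.
    by move=> a; rewrite eq_sym => /negbTE ->.
over.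
rewrite sumr_const card_ord; case: m => [|m]; first by rewrite mulr0n mulr0 ler01.
by rewrite mulVf ?pnatr_eq0.
Qed.

End Averages.

Lemma sorted_index (w : seq nat) : uniq w -> sorted (fun x y => index x w < index y w) w.
Proof.
by move=> uw; apply/(sortedP 0) => i iw; rewrite !index_uniq // ltnW.
Qed.

Lemma has_patternP k sg v w : uniq w -> uniq v -> {subset v <= w} ->
  sg \in perms k -> size v = k ->
  reflect (forall i j, i < k -> j < k ->
     (index i sg < index j sg) = (index (nth 0 v i) w < index (nth 0 v j) w))
    (has_pattern sg v w).
Proof.
move=> uw uv vw sgP vk; pose r x y := index x w < index y w.
have rt : transitive r by move=> y x z; exact: ltn_trans.
have ri : irreflexive r by move=> x; exact: ltnn.
have sgk i : (i \in sg) = (i < k) by rewrite (perms_mem _ sgP).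
have usg := perms_uniq_seq sgP.
have sF : sorted r [seq y <- w | y \in v].
  by apply: sorted_filter => //; exact: sorted_index.
apply: (iffP eqP) => [E|H].
  have L i j : i < k -> j < k -> index i sg < index j sg -> r (nth 0 v i) (nth 0 v j).
    move=> ik jk ij; move: sF; rewrite E sorted_map => sS.
    apply: (sorted_ltn_index (leT := relpre (nth 0 v) r) _ sS) => //; rewrite ?sgk //.
    by move=> y x z; exact: rt.
  move=> i j ik jk; apply/idP/idP; first exact: L.
  case: (ltngtP (index i sg) (index j sg)) => // [ji|ij].
    by have := L j i jk ik ji; rewrite /r; lia.
  have -> : i = j; last by rewrite ltnn.
  by rewrite -[i](nth_index 0 (s := sg)) ?sgk // ij nth_index ?sgk.
apply: (irr_sorted_eq rt ri sF).
  rewrite sorted_map; apply: (sub_in_sorted (P := gtn k)) (sorted_index usg).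
    by move=> i j ik jk /=; rewrite H.
  by apply/allP => i; rewrite sgk.
move=> y; rewrite mem_filter; apply/andP/mapP => [[yv _]|[i]].
  exists (index y v); last by rewrite nth_index.
  by rewrite sgk -vk index_mem.
by rewrite sgk -vk => iv ->; rewrite mem_nth // vw ?mem_nth.
Qed.

Section Sandwich.
Variables (R : realFieldType) (n k : nat) (e : seq bool) (sg : seq nat).
Variables (N : nat) (ty : 'I_N -> option bool) (cpos : nat -> option 'I_N).
Hypotheses (sgP : sg \in perms k) (se : size e = n.-1) (kn : k < n).
Hypothesis cpos_order : forall p p' a b, p < n -> p' < n ->
  cpos p = Some a -> cpos p' = Some b -> a < b -> p < p'.
Hypothesis cpos_run : forall p p' a d i, p <= i < p' -> p' < n ->
  cpos p = Some a -> cpos p' = Some a -> ty a = Some d -> nth false e i = d.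

Lemma nth_neq_succ (w : seq nat) i : uniq w -> i.+1 < size w -> nth 0 w i != nth 0 w i.+1.
Proof. by move=> uw iw; rewrite nth_uniq // ?ltn_eqF // ltnW. Qed.

Lemma monotone_run w (d : bool) p p' : w \in perms n -> descents w == e ->
  p < p' < n -> (forall i, p <= i < p' -> nth false e i = d) ->
  (nth 0 w p' < nth 0 w p) = d.
Proof.
move=> wP dw; have sw := perms_size wP; have uw := perms_uniq_seq wP.
elim: p' => [//|p' IH] /andP[pp pn] H.
have S : (nth 0 w p'.+1 < nth 0 w p') = d.
  rewrite -(H p') ?leqnn ?andbT //.
  by have /(eq_descents sw se) := dw; apply.
have ne := nth_neq_succ uw (_ : p'.+1 < size w).
move: pp; rewrite ltnS leq_eqVlt => /orP[/eqP -> //|pp].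
have {}IH : (nth 0 w p' < nth 0 w p) = d.
  by apply: IH => [|i /andP[pi ip]]; [rewrite pp ltnW | apply: H; rewrite pi ltnW].
have {}ne := ne ltac:(by rewrite sw).
by case: d S IH {H}; lia.
Qed.

(** Cells are ordered along the positions, which decides values in different cells. Two values in
    one cell force it to be a run, where [w] is monotone in the direction given by the type; as [v]
    is sorted, comparing values means comparing their ranks. *)
Lemma precedes_index w v i j : w \in perms n -> descents w == e ->
  sorted ltn v -> all (gtn n) v -> uncrowded ty [seq cpos (index y w) | y <- v] ->
  i < size v -> j < size v ->
  (index (nth 0 v i) w < index (nth 0 v j) w) =
  precedes ty [seq cpos (index y w) | y <- v] i j.
Proof.
move=> wP dw sv nv sep iv jv; rewrite /precedes.
have sw := perms_size wP.
have vin x : x < size v -> nth 0 v x \in w.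
  by move=> xv; rewrite (perms_mem _ wP); exact: (allP nv _ (mem_nth 0 xv)).
have pn x : x < size v -> index (nth 0 v x) w < n.
  by move=> xv; rewrite -sw index_mem vin.
have := uncrowded_nth sep (_ : i < size _); rewrite size_map => /(_ iv).
have := uncrowded_nth sep (_ : j < size _); rewrite size_map => /(_ jv).
case jE : (nth None _ j) => [b|] // _; case iE : (nth None _ i) => [a|] // _.
have iE' : cpos (index (nth 0 v i) w) = Some a by rewrite -iE (nth_map 0).
have jE' : cpos (index (nth 0 v j) w) = Some b by rewrite -jE (nth_map 0).
case: (ltngtP a b) => [ab|ba|/val_inj ab] /=.
- by rewrite (cpos_order _ _ iE' jE' ab) ?pn.
- have := cpos_order (pn _ jv) (pn _ iv) jE' iE' ba.
  by rewrite (_ : (a == b) = false) /=; [lia | apply/eqP => E; rewrite E ltnn in ba].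
rewrite ab eqxx /=; subst b.
case: (eqVneq i j) => [->|ij]; first by rewrite ltnn; case: (ty a) => [[]|]; rewrite ?ltnn.
have := uncrowded_neq sep _ _ ij iE jE; rewrite !size_map => /(_ iv jv).
case tE : (ty a) => [d|] // _.
have mono x y : x < size v -> y < size v -> cpos (index (nth 0 v x) w) = Some a ->
    cpos (index (nth 0 v y) w) = Some a -> index (nth 0 v x) w < index (nth 0 v y) w ->
    (y < x) = d.
  move=> xv yv xE yE xy.
  have := monotone_run wP dw (p := index (nth 0 v x) w) (p' := index (nth 0 v y) w) (d := d).
  rewrite xy pn // !nth_index ?vin // => /(_ isT) <-.
    apply/idP/idP => [yx|]; first by apply: (sorted_ltn_nth ltn_trans 0 sv).
    apply: contraTT; rewrite -!leqNgt => xy'.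
    by apply: (sorted_leq_nth leq_trans leqnn 0 _); rewrite // (sub_sorted _ sv) //; exact: ltnW.
  by move=> z zI; apply: (cpos_run zI _ xE yE tE); exact: pn.
case: (ltngtP (index (nth 0 v i) w) (index (nth 0 v j) w)) => [lij|lji|Eij].
- by have := mono i j iv jv iE' jE' lij; case: d {mono tE} => [|]; lia.
- by have := mono j i jv iv jE' iE' lji; case: d {mono tE} => [|]; lia.
- have uv : uniq v by exact: sorted_uniq ltn_trans ltnn _ sv.
  have : nth 0 v i = nth 0 v j by rewrite -[LHS](nth_index 0 (vin _ iv)) Eij nth_index // vin.
  by move/eqP; rewrite nth_uniq // (negbTE ij).
Qed.

Local Open Scope ring_scope.

Lemma pattern_bounds w v : w \in perms n -> descents w == e ->
  sorted ltn v -> all (gtn n) v -> size v = k ->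
  lower_ind ty R sg [seq cpos (index y w) | y <- v] <= (has_pattern sg v w)%:R
  <= upper_ind ty R sg [seq cpos (index y w) | y <- v].
Proof.
move=> wP dw sv nv vk; rewrite /lower_ind /upper_ind.
case: (boolP (uncrowded _ _)) => [sep|_] /=; last by rewrite ler0n -[1]/(1%:R) ler_nat leq_b1.
have uv : uniq v by exact: sorted_uniq ltn_trans ltnn _ sv.
have vw : {subset v <= w} by move=> x /(allP nv); rewrite (perms_mem _ wP).
rewrite (_ : has_pattern sg v w = realizes ty sg [seq cpos (index y w) | y <- v]) ?lexx //.
apply/(has_patternP (perms_uniq_seq wP) uv vw sgP vk)/realizesP; rewrite (perms_size sgP) => H i j ik jk.
  by rewrite H // precedes_index ?vk.
by rewrite H // precedes_index ?vk.
Qed.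

(** The divisor [k.+1] also serves the empty pattern [k = 0], and [k < n] makes the blocks
    nonempty. *)
Let m := (n %/ k.+1)%N.

Lemma in_blocks_sorted v : size v = k -> in_blocks m 0 v -> sorted ltn v /\ all (gtn n) v.
Proof.
move=> vk bv; split.
  apply/(sortedP 0%N) => i iv; have := bv i (ltnW iv); have := bv i.+1 iv.
  by rewrite !add0n => /andP[a _] /andP[_ b]; exact: leq_trans b a.
apply/(all_nthP 0%N) => i iv; have /andP[_] := bv i iv; rewrite add0n /= => /leq_trans; apply.
by apply: leq_trans (leq_trunc_div n k.+1); rewrite mulnC leq_mul2l; apply/orP; right; lia.
Qed.

Definition freq (w : seq nat) := block_freq R m (fun y => cpos (index y w)).

(** The count does not depend on the observed values, hence equals its average over the blocks.
    After exchanging this average with the sum over permutations, each permutation that is not [bad]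
    contributes an average enclosed by expectations over cells close to those for [l]. Bad ones err
    by at most 1 each, which [beta] pays for. *)
Lemma pattern_count_sandwich (l : option 'I_N -> R) (th beta : R) (bad : pred (seq nat)) :
  (forall a, 0 <= l a) -> \sum_a l a <= 1 -> 0 <= th -> 0 <= beta ->
  (forall w i a, w \in perms n -> descents w == e -> ~~ bad w -> (i < k)%N ->
     `|freq w i a - l a| <= th) ->
  (count (fun w => (descents w == e) && bad w) (perms n))%:R <=
     beta * (count (fun w => descents w == e) (perms n))%:R ->
  (wsum k (fun=> l) (lower_ind ty R sg) - (k%:R * N.+1%:R * th + beta)) *
    (count (fun w => descents w == e) (perms n))%:R <=
  (count (fun w => (descents w == e) && has_pattern sg (iota 0 k) w) (perms n))%:R <=
  (wsum k (fun=> l) (upper_ind ty R sg) + (k%:R * N.+1%:R * th + beta)) *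
    (count (fun w => descents w == e) (perms n))%:R.
Proof.
move=> l0 l1 th0 b0 close badC.
set A : R := (count (fun w => descents w == e) (perms n))%:R.
set B : R := (count (fun w => _ && has_pattern _ _ w) (perms n))%:R.
set err := _ + beta.
have m0 : (0 < m)%N by rewrite divn_gt0.
have pl : subprob (fun=> l) by move=> i.
pose f w := block_avg m k 0 (fun v => (has_pattern sg v w)%:R : R).
have BE : B = \sum_(w <- perms n | descents w == e) f w.
  rewrite -block_avg_sum; transitivity (block_avg m k 0 (fun=> B)); first by rewrite block_avg_cst.
  suff E v : size v = k -> in_blocks m 0 v -> B = \sum_(w <- perms n | descents w == e) (has_pattern sg v w)%:R.
    by apply/le_anti/andP; split; apply: block_avg_le => v vk bv; rewrite -(E v vk bv).
  move=> vk bv; have [sv nv] := in_blocks_sorted vk bv.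
  rewrite /B -vk -(count_pattern_sorted e _ sv nv); last first.
    by apply/allP => i; rewrite /= vk (perms_mem _ sgP).
  by rewrite -sum1_count natr_sum big_mkcondr; apply: eq_bigr => w _; case: has_pattern.
have AE (x : R) : \sum_(w <- perms n | descents w == e) x = x * A.
  by rewrite big_const_seq iter_addr_0 mulr_natr.
have AB : \sum_(w <- perms n | descents w == e) (bad w)%:R <= beta * A.
  apply: le_trans badC; rewrite -sum1_count natr_sum big_mkcondr /=.
  by rewrite le_eqVlt; apply/orP; left; apply/eqP/eq_bigr => w _; case: (bad w).
have cardC : #|{: option 'I_N}| = N.+1 by rewrite card_option card_ord.
have fb w : w \in perms n -> descents w == e ->
    wsum k (fun=> l) (lower_ind ty R sg) - k%:R * N.+1%:R * th - (bad w)%:R <= f w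
    <= wsum k (fun=> l) (upper_ind ty R sg) + k%:R * N.+1%:R * th + (bad w)%:R.
  move=> wP dw.
  have kt : 0 <= k%:R * N.+1%:R * th by rewrite !mulr_ge0.
  have /andP[L0 L1] := wsum01 k pl (lower_ind01 ty R sg).
  have /andP[U0 U1] := wsum01 k pl (upper_ind01 ty R sg).
  have f0 : 0 <= f w.
    by rewrite -(block_avg_cst k 0 (0 : R) m0); apply: block_avg_le.
  have f1 : f w <= 1.
    rewrite -(block_avg_cst k 0 (1 : R) m0); apply: block_avg_le => v _ _.
    by rewrite -[1]/(1%:R) ler_nat leq_b1.
  case: (boolP (bad w)) => [_|gw] /=; first by lra.
  have pq := subprob_block_freq R m (fun y => cpos (index y w)).
  have fl : wsum k (freq w) (lower_ind ty R sg) <= f w.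
    rewrite (_ : wsum _ _ _ = wsum k (fun i => freq w (0 + i)) (lower_ind ty R sg)) //.
    rewrite -block_avg_cells; apply: block_avg_le => v vk bv.
    have [sv nv] := in_blocks_sorted vk bv.
    by have /andP[] := pattern_bounds wP dw sv nv vk.
  have fu : f w <= wsum k (freq w) (upper_ind ty R sg).
    rewrite (_ : wsum _ _ _ = wsum k (fun i => freq w (0 + i)) (upper_ind ty R sg)) //.
    rewrite -block_avg_cells; apply: block_avg_le => v vk bv.
    have [sv nv] := in_blocks_sorted vk bv.
    by have /andP[] := pattern_bounds wP dw sv nv vk.
  have cl := @wsum_close R _ k (freq w) (fun=> l) (lower_ind ty R sg) th pq pl (lower_ind01 ty R sg) th0 (fun i a ik => close w i a wP dw gw ik).
  have cu := @wsum_close R _ k (freq w) (fun=> l) (upper_ind ty R sg) th pq pl (upper_ind01 ty R sg) th0 (fun i a ik => close w i a wP dw gw ik).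
  move: cl cu; rewrite cardC !ler_distl; lra.
rewrite BE; apply/andP; split.
  apply: (@le_trans _ _ (\sum_(w <- perms n | descents w == e)
     (wsum k (fun=> l) (lower_ind ty R sg) - k%:R * N.+1%:R * th - (bad w)%:R))).
    rewrite big_split /= AE sumrN /err; move: AB; lra.
  by rewrite [leLHS]big_seq_cond [leRHS]big_seq_cond; apply: ler_sum => w /andP[wP dw]; case/andP: (fb w wP dw).
apply: (@le_trans _ _ (\sum_(w <- perms n | descents w == e)
     (wsum k (fun=> l) (upper_ind ty R sg) + k%:R * N.+1%:R * th + (bad w)%:R))).
  by rewrite [leLHS]big_seq_cond [leRHS]big_seq_cond; apply: ler_sum => w /andP[wP dw]; case/andP: (fb w wP dw).
rewrite big_split /= AE /err; move: AB; lra.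
Qed.

End Sandwich.

(** * Frequencies of cells in blocks of values *)

Lemma map_index_uniq (w : seq nat) : uniq w -> map (index^~ w) w = iota 0 (size w).
Proof.
move=> uw; apply: (@eq_from_nth _ 0); first by rewrite size_map size_iota.
by move=> i; rewrite size_map => iw; rewrite (nth_map 0) // index_uniq // nth_iota.
Qed.

Lemma count_index_perms n w (P : pred nat) : w \in perms n ->
  count (fun y => P (index y w)) (iota 0 n) = count P (iota 0 n).
Proof.
move=> wP; rewrite -{2}(perms_size wP) -(map_index_uniq (perms_uniq_seq wP)) count_map.
by move: wP; rewrite mem_perms => /seq.permP ->.
Qed.

Lemma count_take_index n w c j : w \in perms n -> j <= n ->
  count (gtn j) (take c w) = count (fun y => index y w < c) (iota 0 j).
Proof.
move=> wP jn; rewrite -!size_filter; apply: perm_size; apply: uniq_perm.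
- by rewrite filter_uniq // take_uniq // (perms_uniq_seq wP).
- by rewrite filter_uniq // iota_uniq.
move=> y; rewrite !mem_filter mem_iota /= add0n [RHS]andbC; case: ltnP => //= yj.
by rewrite in_take // (perms_mem _ wP) (leq_trans yj).
Qed.

Section Frequencies.
Variable R : realFieldType.
Local Open Scope ring_scope.

Lemma sum_block (P : pred nat) m i :
  \sum_(u < m) (P (i * m + u)%N)%:R = (count P (iota (i * m) m))%:R :> R.
Proof.
rewrite -sum1_count natr_sum -{2}[(i * m)%N]addn0 iotaDl big_map.
rewrite -[m in iota _ m]subn0 -[iota _ _]/(index_iota _ _) big_mkord /=.
by rewrite [RHS]big_mkcond; apply: eq_bigr => u _; case: (P _).
Qed.

Definition deviates n k N (c : nat -> nat) (d : R) (w : seq nat) : bool :=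
  has (fun a => has (fun i => 2 * d * n%:R ^+ 2 <=
      `|(count (gtn (i * (n %/ k.+1))%N) (take (c a) w))%:R * n%:R -
        (c a)%:R * (i * (n %/ k.+1))%N%:R|) (iota 0 k.+1)) (iota 0 N.+1).

Lemma count_deviates n k N c e (d : R) t : (0 < n)%N -> size e = n.-1 ->
  0 < d <= 1 -> t%:R <= d * n%:R -> (forall a, (a <= N)%N -> cut_point n e (c a)) ->
  (count (fun w => (descents w == e) && deviates n k N c d w) (perms n))%:R <=
  N.+1%:R * k.+1%:R * (n%:R * n.+1%:R * (1 - d) ^+ t) *
  (count (fun w => descents w == e) (perms n))%:R.
Proof.
move=> n0 se d01 td cc; set A := (count (fun w => descents w == e) _)%:R.
pose P a i w := 2 * d * n%:R ^+ 2 <=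
      `|(count (gtn (i * (n %/ k.+1))%N) (take (c a) w))%:R * n%:R -
        (c a)%:R * (i * (n %/ k.+1))%N%:R|.
have H : (count (fun w => (descents w == e) && deviates n k N c d w) (perms n) <=
    \sum_(a < N.+1) \sum_(i < k.+1) count (fun w => (descents w == e) && P a i w) (perms n))%N.
  under eq_bigr do under eq_bigr do rewrite -sum1_count big_mkcond.
  under eq_bigr do rewrite exchange_big.
  rewrite exchange_big /= -sum1_count big_mkcond; apply: leq_sum => w _.
  case: ifP => // /andP[dw /hasP[a + /hasP[i]]]; rewrite !mem_iota !add0n => /= aN ik Pw.
  by rewrite (bigD1 (Ordinal aN)) //= (bigD1 (Ordinal ik)) //= dw /P Pw /= -addnA addn_gt0.
move: H; rewrite -(ler_nat R) => /le_trans; apply; rewrite natr_sum.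
apply: (@le_trans _ _ (\sum_(a < N.+1) \sum_(i < k.+1) n%:R * n.+1%:R * (1 - d) ^+ t * A)).
  apply: ler_sum => a _; rewrite natr_sum; apply: ler_sum => i _.
  apply: cut_point_concentration => //; last by apply: cc; rewrite -ltnS.
  by apply: leq_trans (leq_trunc_div n k.+1); rewrite mulnC leq_mul2l; apply/orP; right; exact: ltnW.
rewrite !sumr_const !card_ord -!mulrnA -[leLHS]mulr_natl natrM.
by rewrite le_eqVlt; apply/orP; left; apply/eqP; ring.
Qed.

(** Up to junk, the number of values of block [i] in cell [a] is a double difference of counts of
    values below a block boundary at positions below a cut. Four deviations of [2 d n] give [8 d n],
    junk adds [s], and [rho] compares the spacing of the cuts with the ideal lengths. *)
Lemma freq_close n k N (cpos : nat -> option 'I_N) (c : nat -> nat) (d s rho : R)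
    (l : option 'I_N -> R) w i a :
  (k < n)%N -> w \in perms n -> (i < k)%N ->
  (forall p (a : 'I_N), (p < n)%N -> cpos p != None ->
     ((cpos p == Some a) + (p < c a) = (p < c a.+1))%N) ->
  (count (fun p => cpos p == None) (iota 0 n))%:R <= s ->
  l None = 0 ->
  (forall a : 'I_N, `|((c a.+1)%:R - (c a)%:R) / n%:R - l (Some a)| <= rho) ->
  0 <= rho -> 0 <= d -> ~~ deviates n k N c d w ->
  `|freq R n k cpos w i a - l a| <=
    (8 * d * n%:R + s) / (n %/ k.+1)%:R + rho.
Proof.
move=> kn wP ik cut junk lN lc rho0 d0 dev; rewrite /freq /block_freq.
set m := (n %/ k.+1)%N.
have m0 : 0 < m%:R :> R by rewrite ltr0n divn_gt0.
have n0 : 0 < n%:R :> R by rewrite ltr0n; lia.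
have s0 : 0 <= s by apply: le_trans junk.
have imn : (i.+1 * m <= n)%N.
  by apply: leq_trans (leq_trunc_div n k.+1); rewrite mulnC leq_mul2l; apply/orP; right; exact: ltnW.
have imn' : (i * m + m = i.+1 * m)%N by rewrite mulSn addnC.
have wn y : (y < n)%N -> (index y w < n)%N by rewrite -{2}(perms_size wP) index_mem (perms_mem _ wP).
have junkb : (count (fun y => cpos (index y w) == None) (iota (i * m) m))%:R <= s.
  apply: le_trans junk; rewrite ler_nat -(count_index_perms (fun p => cpos p == None) wP).
  have -> : iota 0 n = iota 0 (i * m) ++ iota (i * m) m ++ iota (i.+1 * m) (n - i.+1 * m).
    by rewrite catA -iotaD imn' -{1}[(i.+1 * m)%N]add0n -iotaD subnKC.
  by rewrite !count_cat addnCA leq_addr.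
rewrite (sum_block (fun y => cpos (index y w) == a)).
case: a => [a|]; last first.
  rewrite lN subr0 ger0_norm ?mulr_ge0 ?invr_ge0 // mulrC -[leLHS]addr0 lerD //.
  by rewrite ler_pM2r ?invr_gt0 // (le_trans junkb) // lerDr !mulr_ge0.
pose X cc j : R := (count (fun y => index y w < cc)%N (iota 0 j))%:R.
have devX b j : (b <= N)%N -> (j <= k)%N -> `|X (c b) (j * m)%N * n%:R - (c b)%:R * (j * m)%:R| <= 2 * d * n%:R ^+ 2.
  move=> bN jk; rewrite leNgt; apply/negP => /ltW H; move/hasPn: dev => /(_ b).
  rewrite mem_iota add0n ltnS bN => /(_ isT)/hasPn/(_ j).
  rewrite mem_iota add0n ltnS jk => /(_ isT)/negP; apply.
  rewrite (count_take_index _ wP) //; apply: leq_trans (leq_trunc_div n k.+1).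
  by rewrite mulnC leq_mul2l; apply/orP; right; exact: leqW.
have XB cc : (count (fun y => index y w < cc)%N (iota (i * m) m))%:R = X cc (i.+1 * m)%N - X cc (i * m)%N.
  by rewrite /X -imn' iotaD count_cat add0n natrD addrC addKr.
set M := (count _ _)%:R.
(* At a position that is not junk, [cut] makes the indicator of cell [a] the difference of the
   indicators of lying left of its two cuts; each junk position costs at most 1. *)
have MD : `|M - ((X (c a.+1) (i.+1 * m)%N - X (c a.+1) (i * m)%N) -
                 (X (c a) (i.+1 * m)%N - X (c a) (i * m)%N))| <= s.
  apply: le_trans junkb; rewrite -!XB /M.
  have rn y : y \in iota (i * m) m -> (y < n)%N.
    by rewrite mem_iota imn' => /andP[_ /leq_trans]; apply.
  elim: (iota (i * m) m) rn => [|y r IH] rn.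
    by rewrite /= !subr0 normr0.
  have yn : (y < n)%N by apply: rn; rewrite mem_head.
  have {IH} : _ := IH (fun z zr => rn z (mem_behead (s := y :: r) zr)).
  rewrite /= !natrD; set u1 := (count _ r)%:R; set u2 := (count _ r)%:R; set u3 := (count _ r)%:R; set u4 := (count _ r)%:R.
  have := cut (index y w) a (wn y yn); case: (eqVneq (cpos (index y w)) None) => [-> _|_ /(_ isT) <-] /=.
    by case: (_ < c a)%N; case: (_ < _)%N; rewrite /= !ler_distl; lra.
  by rewrite natrD !ler_distl; lra.
have aN : (a < N)%N by exact: ltn_ord.
have := devX a.+1 i.+1 aN ik; have := devX a.+1 i aN (ltnW ik).
have := devX a i.+1 (ltnW aN) ik; have := devX a i (ltnW aN) (ltnW ik).
have lca := lc a.
move: MD lca; rewrite -imn' natrD.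
move: (X (c a.+1) (i * m + m)%N) (X (c a.+1) (i * m)%N) (X (c a) (i * m + m)%N)
  (X (c a) (i * m)%N) => X1 X2 X3 X4.
move: (i * m)%:R (c a.+1)%:R (c a)%:R m0 n0 => im C1 C0 m0 n0 MD lca H1 H2 H3 H4.
pose D := X1 - X2 - (X3 - X4).
have HD : `|D * n%:R - (C1 - C0) * m%:R| <= 8 * d * n%:R ^+ 2.
  move: H1 H2 H3 H4; rewrite /D !ler_distl; lra.
rewrite (_ : _ - l _ = (m%:R^-1 * (M - D)) + (m%:R^-1 * n%:R^-1 * (D * n%:R - (C1 - C0) * m%:R))
    + ((C1 - C0) / n%:R - l (Some a))); last first.
  by field; rewrite !gt_eqF.
apply: (le_trans (ler_normD _ _)); apply: lerD => //.
apply: (le_trans (ler_normD _ _)); rewrite !normrM ![`|_^-1|]gtr0_norm ?invr_gt0 //.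
rewrite addrC [leRHS]mulrDl; apply: lerD; last by rewrite mulrC ler_pM2r ?invr_gt0.
rewrite -mulrA mulrC ler_pM2r ?invr_gt0 // mulrC ler_pdivrMr //.
by rewrite (le_trans HD) // expr2; lra.
Qed.

End Frequencies.

Import numFieldNormedType.Exports.
Local Open Scope classical_set_scope.
Local Open Scope ring_scope.

(** * Hausdorff distance and sign changes *)

Section Geometry.
Variable R : realType.
Implicit Types (A B : set R) (x y eta : R).

Definition near_set eta A B := forall a, A a -> exists2 b, B b & `|a - b| < eta.

Lemma near_set_sup eta A B : A `<=` `[0, 1] -> B `<=` `[0, 1] -> B !=set0 ->
  sup [set dist_set B a | a in A] < eta -> near_set eta A B.
Proof.
move=> A1 B1 B0 sup_lt a Aa.
have E0 : [set `|a - b| | b in B] !=set0 by case: B0 => b Bb; exists `|a - b|, b.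
suff /inf_lt : dist_set B a < eta.
  by move=> /(_ E0)[_ [b Bb <-] ab]; exists b.
apply: le_lt_trans sup_lt; apply: ub_le_sup; last by exists a.
exists 1 => _ [c Ac <-]; case: B0 => b Bb.
apply: (@le_trans _ _ `|c - b|).
  by apply: ge_inf; [exists 0 => _ [z _ <-] | exists b].
by have := A1 _ Ac; have := B1 _ Bb; rewrite /= !in_itv /= => /andP[? ?] /andP[? ?]; rewrite ler_distl; lra.
Qed.

Lemma near_set_hausdorff eta A B : A `<=` `[0, 1] -> B `<=` `[0, 1] ->
  A !=set0 -> B !=set0 -> hausdorff A B < eta -> near_set eta A B /\ near_set eta B A.
Proof.
by move=> A1 B1 A0 B0; rewrite /hausdorff gt_max => /andP[h1 h2]; split; apply: near_set_sup.
Qed.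

Definition sign_segments n (e : seq bool) (b : bool) : set R :=
  \bigcup_(s in [set s : nat | (1 <= s <= n.-1)%N /\ nth false e s.-1 = b]) @Iseg R n s.

Lemma UlamE n lam : is_comp n lam ->
  Ulam R lam = (interior (sign_segments n (cword lam) false),
                interior (sign_segments n (cword lam) true)).
Proof.
move=> cl; rewrite /Ulam; have -> : sumn lam = n by case/andP: cl => _ /eqP.
rewrite /sign_segments; congr (interior _, interior _); congr bigcup => //;
  apply/seteqP; split => s /= []; rewrite (mem_Dcomp _ cl) => sn; rewrite sn;
  case/andP: sn => -> _ /=; by [move=> /negbTE -> | move=> ->].
Qed.

Lemma sign_segments01 n e b : (1 < n)%N -> sign_segments n e b `<=` `[0, 1].
Proof.
move=> n1 x [s /= [/andP[s1 sn] _]]; rewrite /Iseg /= !in_itv /= => /andP[x1 x2].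
have N0 : 0 < n.-1%:R :> R by rewrite ltr0n; lia.
rewrite (le_trans _ x1) ?divr_ge0 //= (le_trans x2) // ler_pdivrMr // mul1r ler_nat //.
Qed.

Lemma interior_sub_itv A : A `<=` `[0, 1] -> interior A `<=` `]0, 1[.
Proof.
move=> A1 x; rewrite /interior => /nbhs_ballP[r /= r0 rA].
have /rA/A1 : ball x r (x + r / 2).
  by rewrite /ball /= opprD addrA subrr sub0r normrN gtr0_norm; lra.
have /rA/A1 : ball x r (x - r / 2).
  by rewrite /ball /= opprB addrCA subrr addr0 gtr0_norm; lra.
rewrite /= !in_itv /=; lra.
Qed.

Lemma compl01_nonempty A : A `<=` `]0, 1[ -> compl01 A !=set0.
Proof.
move=> A1; exists 0; split; first by rewrite /= in_itv /= lexx ler01.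
by move=> /A1; rewrite /= in_itv /= ltxx.
Qed.

Lemma compl01_sub A : compl01 A `<=` `[0, 1].
Proof. by move=> x []. Qed.

(** If all segments near [x] had sign [b], they would cover a ball around [x] and [x] would be
    interior. The ball must stay in [[0, 1]], whence the two exceptions near the ends. *)
Lemma opposite_sign_near n e b x : (1 < n)%N ->
  compl01 (interior (sign_segments n e b)) x ->
  [\/ x <= n.-1%:R^-1, 1 - n.-1%:R^-1 <= x |
   exists i, [/\ (i < n.-1)%N, nth false e i = ~~ b & `|i%:R / n.-1%:R - x| <= 2 / n.-1%:R]].
Proof.
move=> n1 [_ xI]; have N0 : 0 < n.-1%:R :> R by rewrite ltr0n; lia.
set N := n.-1 in N0 *.
have [x1|x1] := leP x N%:R^-1; first by apply: Or31.
have [x2|x2] := leP (1 - N%:R^-1) x; first by apply: Or32.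
apply: Or33; apply: contrapT => H; apply: xI; rewrite /interior.
apply/nbhs_ballP; exists N%:R^-1; first by rewrite /= invr_gt0.
move=> y; rewrite /ball /= ltr_distl => /andP[y1 y2].
have yN : 0 <= y * N%:R by apply: mulr_ge0; lra.
have /andP[t1 t2] := truncn_itv yN; set i := Num.truncn (y * N%:R) in t1 t2.
have iN : (i < N)%N.
  rewrite -(ltr_nat R) (le_lt_trans t1) // -[ltRHS]mul1r ltr_pM2r //; lra.
exists i.+1; last first.
  by rewrite /Iseg /= in_itv /= ler_pdivrMr // t1 /= ler_pdivlMr // ltW.
split => //=; apply/eqP; apply: contraPT H => ib Hi; apply: Hi; exists i; split => //.
  by move: ib; case: b; case: nth.
have j1 : i%:R / N%:R <= y by rewrite ler_pdivrMr.
have j2 : y - N%:R^-1 <= i%:R / N%:R.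
  rewrite -(ler_pM2r N0) mulrBl mulVf ?gt_eqF // divfK ?gt_eqF //.
  by move: t2; rewrite -natr1; lra.
rewrite ler_distl; lra.
Qed.

(** A midpoint belongs to one segment only, whereas an endpoint may also belong to a neighbour of
    the other sign. *)
Lemma midpoint_compl n e b i : (i < n.-1)%N -> nth false e i = ~~ b ->
  compl01 (interior (sign_segments n e b)) ((i%:R + 2^-1) / n.-1%:R).
Proof.
move=> iN eb; set N := n.-1 in iN *.
have N0 : 0 < N%:R :> R by rewrite ltr0n; lia.
have i1 : i%:R + 1 <= N%:R :> R by rewrite natr1 ler_nat.
have i0 : 0 <= i%:R :> R by [].
split.
  rewrite /= in_itv /=; apply/andP; split; last by rewrite ler_pdivrMr //; lra.
  by rewrite divr_ge0 ?(ltW N0) //; lra.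
move=> /interior_subset[s /= [/andP[s1 sn] sb]]; rewrite /Iseg /= in_itv /= -/N.
rewrite ler_pM2r ?invr_gt0 // ler_pM2r ?invr_gt0 // => /andP[h1 h2].
suff E : s.-1 = i by move: sb; rewrite E eb; case: b {eb}.
apply/eqP; rewrite eqn_leq; apply/andP; split.
  by rewrite -ltnS -(ltr_nat R) -natr1; lra.
by rewrite -ltnS prednK // -(ltr_nat R); lra.
Qed.

Lemma sign_change (e : nat -> bool) i j : (i < j)%N -> e i != e j ->
  exists2 t, (i <= t < j)%N & e t != e t.+1.
Proof.
elim: j => [//|j IH]; rewrite ltnS leq_eqVlt => /orP[/eqP ->|ij] eij.
  by exists j; rewrite ?leqnn ?ltnSn.
case: (eqVneq (e j) (e j.+1)) => [E|E]; last by exists j; rewrite ?(ltnW ij) ?ltnSn.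
rewrite -E in eij; have [t /andP[it tj] H] := IH ij eij.
by exists t; rewrite // it /= leqW.
Qed.

Lemma sign_change_between (e : nat -> bool) i j : e i != e j ->
  exists2 t, (minn i j <= t < maxn i j)%N & e t != e t.+1.
Proof.
case: (ltngtP i j) => [ij|ji|->]; last by rewrite eqxx.
  exact: sign_change.
by rewrite eq_sym; exact: sign_change.
Qed.

(** A point outside both open sets is close to the complements of both discrete ones, hence to
    segments of both signs, and between these the sign changes. Of the constant 4, one 2 is the
    distance to these segments and the other the rounding from a sign index to a cut. *)
Lemma cut_point_near n e (Uu Ud : set R) eta x : (1 < n)%N -> 0 <= x <= 1 ->
  ~ Uu x -> ~ Ud x ->
  near_set eta (compl01 Uu) (compl01 (interior (sign_segments n e false))) ->
  near_set eta (compl01 Ud) (compl01 (interior (sign_segments n e true))) ->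
  exists2 c, cut_point n e c & `|c%:R / n%:R - x| <= eta + 4 / n.-1%:R.
Proof.
move=> n1 x01 xu xd nu nd.
have N0 : 0 < n.-1%:R :> R by rewrite ltr0n; lia.
have n0 : 0 < n%:R :> R by rewrite ltr0n; lia.
have V0 : 0 < n.-1%:R^-1 :> R by rewrite invr_gt0.
have [x1 /(opposite_sign_near n1) h1] : exists2 b, compl01 (interior (sign_segments n e false)) b & `|x - b| < eta by exact: nu.
have [x2 /(opposite_sign_near n1) h2] : exists2 b, compl01 (interior (sign_segments n e true)) b & `|x - b| < eta by exact: nd.
rewrite !ltr_distl => xx2 xx1.
have c0 z : z - eta < x < z + eta -> z <= n.-1%:R^-1 ->
    exists2 c, cut_point n e c & `|c%:R / n%:R - x| <= eta + 4 / n.-1%:R.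
  by move=> ? ?; exists 0%N; rewrite ?/cut_point ?eqxx // mul0r ler_distl; lra.
have c1 z : z - eta < x < z + eta -> 1 - n.-1%:R^-1 <= z ->
    exists2 c, cut_point n e c & `|c%:R / n%:R - x| <= eta + 4 / n.-1%:R.
  by move=> ? ?; exists n; rewrite ?/cut_point ?eqxx ?orbT // divff ?gt_eqF // ler_distl; lra.
case: h1 => [h|h|[i [iN ei ix]]]; [exact: (c0 x1)|exact: (c1 x1)|].
case: h2 => [h|h|[j [jN ej jx]]]; [exact: (c0 x2)|exact: (c1 x2)|].
have [t /andP[tlo thi] et] : exists2 t, (minn i j <= t < maxn i j)%N & nth false e t != nth false e t.+1.
  by apply: (sign_change_between (e := nth false e)); rewrite ei ej.
have tN : (t.+1 < n.-1)%N by apply: leq_ltn_trans thi _; rewrite gtn_max iN jN.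
have tn : (t.+2 < n)%N by move: tN; rewrite -ltnS prednK // ltnW.
(* The signs [t] and [t.+1] differ, so the cut has [c.-2 = t]. *)
exists t.+2.
  by rewrite /cut_point /= et tn !orbT.
have tlo' : i%:R / n.-1%:R <= t%:R / n.-1%:R :> R \/ j%:R / n.-1%:R <= t%:R / n.-1%:R :> R.
  by move: tlo; rewrite geq_min => /orP[h|h]; [left|right]; rewrite ler_pM2r ?invr_gt0 // ler_nat.
have thi' : t%:R / n.-1%:R <= i%:R / n.-1%:R :> R \/ t%:R / n.-1%:R <= j%:R / n.-1%:R :> R.
  by move: (ltnW thi); rewrite leq_max => /orP[h|h]; [left|right]; rewrite ler_pM2r ?invr_gt0 // ler_nat.
have nE : n%:R = n.-1%:R + 1 :> R by rewrite natr1 prednK // ltnW.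
have cE : t.+2%:R / n%:R - t%:R / n.-1%:R = (2 - t%:R / n.-1%:R) / n%:R :> R.
  by rewrite nE -!natr1; field; rewrite -nE !gt_eqF.
have tN1 : t%:R / n.-1%:R <= 1 :> R by rewrite ler_pdivrMr // mul1r ler_nat ltnW // ltnW.
have tN0 : 0 <= t%:R / n.-1%:R :> R by rewrite divr_ge0 // ltW.
have r0 : 0 <= (2 - t%:R / n.-1%:R) / n%:R :> R by rewrite divr_ge0 ?(ltW n0) //; lra.
have r1 : (2 - t%:R / n.-1%:R) / n%:R <= 2 / n.-1%:R :> R.
  apply: ler_pM; rewrite ?invr_ge0 ?(ltW n0) //; try lra.
  by rewrite lef_pV2 ?posrE // ler_nat leq_pred.
move: ix jx cE r0 r1 tlo' thi'; set T := t.+2%:R / _; set T' := t%:R / _; rewrite !ler_distl.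
by move=> ix jx cE r0 r1 [tlo'|tlo'] [thi'|thi']; lra.
Qed.

(** Were the sign wrong, the midpoint of the segment would lie within [eta] of a point outside [U],
    although its open [eta]-neighbourhood is inside the interval. *)
Lemma run_sign n e b (U : set R) eta y z i : (1 < n)%N -> 0 <= y -> z <= 1 ->
  `]y, z[ `<=` U ->
  near_set eta (compl01 (interior (sign_segments n e b))) (compl01 U) ->
  (i < n.-1)%N -> y + eta <= (i%:R + 2^-1) / n.-1%:R <= z - eta ->
  nth false e i = b.
Proof.
move=> n1 y0 z1 yzU nU iN /andP[h1 h2].
case: (eqVneq (nth false e i) b) => // ib.
have eb : nth false e i = ~~ b by move: ib; case: b {nU}; case: nth.
have [p [_ pU]] := nU _ (midpoint_compl iN eb); rewrite ltr_distl => /andP[? ?].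
by exfalso; apply: pU; apply: yzU; rewrite /= in_itv /=; apply/andP; split; lra.
Qed.

End Geometry.

(** * Subdivisions of the unit interval *)

Section Partition.
Variables (R : realType) (Uu Ud : set R).
Hypotheses (oUu : open Uu) (oUd : open Ud).
Hypotheses (Uu01 : Uu `<=` `]0, 1[) (Ud01 : Ud `<=` `]0, 1[) (UuUd : Uu `&` Ud = set0).

Let K : set R := [set x | [/\ 0 <= x <= 1, ~ Uu x & ~ Ud x]].

Definition gap (delta y z : R) : Prop :=
  y < z /\ [\/ z - y <= delta, `]y, z[ `<=` Uu | `]y, z[ `<=` Ud].

(** Division points in [K] serve twice: cuts exist near them, and no component of [Uu] or [Ud]
    reaches across them. *)
Definition subdivision (delta : R) (N : nat) (x : nat -> R) (z : R) : Prop :=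
  [/\ x 0%N = 0, x N = z, forall a, (a <= N)%N -> K (x a) &
      forall a, (a < N)%N -> gap delta (x a) (x a.+1)].

Lemma K0 : K 0.
Proof.
split; first by rewrite lexx ler01.
  by move=> /Uu01; rewrite /= in_itv /= ltxx.
by move=> /Ud01; rewrite /= in_itv /= ltxx.
Qed.

Lemma subdivision0 delta : subdivision delta 0 (fun=> 0) 0.
Proof. by split => // a _; exact: K0. Qed.

Lemma subdivision_step delta N x y z : subdivision delta N x y -> K z -> gap delta y z ->
  exists N' x', subdivision delta N' x' z.
Proof.
move=> [x0 xN xK xg] Kz gyz; exists N.+1, (fun a => if (a <= N)%N then x a else z).
split => [//||a _|a].
- by rewrite ltnn.
- by case: ifP => // aN; exact: xK.
rewrite ltnS => aN; rewrite aN; case: ltngtP aN => // [aN|->] _; first exact: xg.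
by rewrite xN.
Qed.

Lemma K_closed : closed K.
Proof.
have -> : K = `[0, 1] `&` (~` Uu `&` ~` Ud).
  apply/seteqP; split => t /=; first by move=> [t01 tu td]; split => //; rewrite in_itv.
  by move=> [t01 [tu td]]; split => //; move: t01; rewrite in_itv.
by apply: closedI; [exact: interval_closed | apply: closedI; exact: open_closedC].
Qed.

Lemma K_extrema (a b : R) : (exists2 t, K t & a <= t <= b) ->
  (exists y, [/\ K y, a <= y <= b & forall t, K t -> a <= t <= b -> t <= y]) /\
  (exists y, [/\ K y, a <= y <= b & forall t, K t -> a <= t <= b -> y <= t]).
Proof.
move=> [t0 Kt0 abt0].
have A0 : (`[a, b] `&` K) !=set0 by exists t0; split => //; rewrite /= in_itv.
have cA : compact (`[a, b] `&` K).
  apply: (subclosed_compact _ (@segment_compact _ a b)); last exact: subIsetl.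
  by apply: closedI; [exact: interval_closed | exact: K_closed].
have ci : {within `[a, b] `&` K, continuous (fun t : R => t)}.
  by apply: continuous_subspaceT => t; exact: cvg_id.
split.
  have [y /set_mem[]] := compact_EVT_max A0 cA ci; rewrite /= in_itv => aby Ky H.
  by exists y; split => // t Kt abt; apply: H; apply/mem_set; split => //; rewrite /= in_itv.
have [y /set_mem[]] := compact_EVT_min A0 cA ci; rewrite /= in_itv => aby Ky H.
by exists y; split => // t Kt abt; apply: H; apply/mem_set; split => //; rewrite /= in_itv.
Qed.

Lemma gap_in_U (y z : R) : 0 <= y -> z <= 1 -> (forall t, y < t < z -> ~ K t) ->
  `]y, z[ `<=` Uu \/ `]y, z[ `<=` Ud.
Proof.
move=> y0 z1 nK.
have UU t : (`]y, z[)%classic t -> Uu t \/ Ud t.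
  rewrite /= in_itv /= => tyz; apply: contrapT => /not_orP[tu td].
  by apply: (nK t tyz); split => //; lra.
have [[p [pI pU]]|H] := pselect (`]y, z[ `&` Uu !=set0); last first.
  right=> t tI; case: (UU t tI) => // tu; exfalso; apply: H; by exists t.
left; have : connected (`]y, z[%classic : set R) by apply/connected_intervalP; exact: interval_is_interval.
move=> /(_ (`]y, z[ `&` Uu)) <- //; first by exists p.
  by exists Uu.
exists (~` Ud); first exact: open_closedC.
apply/seteqP; split => t [tI tU]; split => //.
  by move=> td; have : (Uu `&` Ud) t by []; rewrite UuUd.
by case: (UU t tI) => // /tU.
Qed.

(** Induction on the number of steps of length [delta] from 0. For [z] in [K] beyond [delta], let
    [y] be the last point of [K] up to [z - delta] and [u] the first one from there on: no point of
    [K] lies between them, the gap from [u] to [z] is short, and [y] is at least [delta] below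
    [z]. *)
Lemma subdivision_exists (delta : R) : 0 < delta -> exists N x, subdivision delta N x 1.
Proof.
move=> d0.
have main j z : K z -> z <= j%:R * delta -> exists N x, subdivision delta N x z.
  elim: j z => [|j IH] z Kz zj.
    have -> : z = 0 by case: Kz => /andP[z0 _] _ _; apply/eqP; rewrite eq_le z0 andbT; move: zj; rewrite mul0r.
    by exists 0%N, (fun=> 0); exact: subdivision0.
  have [/andP[z0 z1] _ _] := Kz.
  have [zd|dz] := leP z delta.
    have [->|zn] := eqVneq z 0; first by exists 0%N, (fun=> 0); exact: subdivision0.
    apply: (subdivision_step (subdivision0 delta) Kz); split; first by rewrite lt_neqAle eq_sym zn.
    by apply: Or31; rewrite subr0.
  have [|[y [Ky /andP[y0 yz] ymax]] _] := @K_extrema 0 (z - delta).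
    by exists 0; [exact: K0 | rewrite lexx; lra].
  have [|_ [u [Ku /andP[zu uz] umin]]] := @K_extrema (z - delta) z.
    by exists z => //; lra.
  have [Ny [xy sy]] : exists N x, subdivision delta N x y.
    by apply: IH => //; move: zj; rewrite -natr1 mulrDl mul1r; lra.
  have [Nu [xu su]] : exists N x, subdivision delta N x u.
    have [<-|yu] := eqVneq y u; first by exists Ny, xy.
    apply: (subdivision_step sy Ku); split; first by rewrite lt_neqAle yu; lra.
    have u1 : u <= 1 by lra.
    case: (@gap_in_U y u y0 u1) => [t /andP[yt tu] Kt|H|H]; [|exact: Or32|exact: Or33].
    have [tz|tz] := leP t (z - delta).
      by have := ymax t Kt; case: Kt => /andP[t0 _] _ _; rewrite t0 tz => /(_ isT); lra.
    have tz' : t <= z by lra.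
    by have := umin t Kt; rewrite (ltW tz) tz' => /(_ isT); lra.
  have [<-|uz'] := eqVneq u z; first by exists Nu, xu.
  apply: (subdivision_step su Kz); split; first by rewrite lt_neqAle uz'.
  by apply: Or31; lra.
have K1 : K 1.
  split; first by rewrite lexx ler01.
    by move=> /Uu01; rewrite /= in_itv /= ltxx andbF.
  by move=> /Ud01; rewrite /= in_itv /= ltxx andbF.
apply: (main (Num.truncn delta^-1).+1 1 K1).
have := truncn_itv (ltW (_ : 0 < delta^-1)); rewrite invr_gt0 => /(_ d0)/andP[_ /ltW].
by rewrite -(ler_pM2r d0) mulVf // gt_eqF.
Qed.

Section CellsOfSubdivision.
Variables (delta : R) (N : nat) (x : nat -> R).
Hypothesis sx : subdivision delta N x 1.

Lemma subdivision_lt a b : (a < b <= N)%N -> x a < x b.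
Proof.
case: sx => _ _ _ xg; elim: b => [//|b IH] /andP[]; rewrite ltnS leq_eqVlt.
move=> /orP[/eqP ->|ab] bN; first by have [] := xg b bN.
by apply: lt_trans (xg b bN).1; apply: IH; rewrite ab ltnW.
Qed.

Lemma subdivision_le a b : (a <= b <= N)%N -> x a <= x b.
Proof.
move=> /andP[]; rewrite leq_eqVlt => /orP[/eqP -> //|ab] bN.
by apply/ltW/subdivision_lt; rewrite ab.
Qed.

Definition cell_of (t : R) : option 'I_N := [pick a : 'I_N | x a < t < x a.+1].

Definition cell_type (a : 'I_N) : option bool :=
  if `[< `]x a, x a.+1[ `<=` Uu >] then Some false
  else if `[< `]x a, x a.+1[ `<=` Ud >] then Some true else None.

Definition cell_length (a : option 'I_N) : R :=
  if a is Some b then x b.+1 - x b else 0.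

Lemma cell_ofP t (a : 'I_N) : (cell_of t == Some a) = (x a < t < x a.+1).
Proof.
rewrite /cell_of; case: pickP => [b bt|H]; last by rewrite H.
apply/eqP/idP => [[<-] //|at']; congr Some; apply/val_inj; apply/eqP.
rewrite eqn_leq; apply/andP; split; rewrite leqNgt; apply/negP => ab.
  have : x a.+1 <= x b by apply: subdivision_le; rewrite ab ltnW.
  by lra.
have : x b.+1 <= x a by apply: subdivision_le; rewrite ab ltnW.
by lra.
Qed.

Lemma cell_of_some t a : cell_of t = Some a -> x a < t < x a.+1.
Proof. by move/eqP; rewrite cell_ofP. Qed.

Lemma cell_of_none t : 0 <= t <= 1 -> cell_of t = None -> exists2 a, (a <= N)%N & t = x a.
Proof.
move=> /andP[t0 t1] tN; case: sx => x0 xN _ _.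
suff H b : (b <= N)%N -> x b < t \/ exists2 a, (a <= N)%N & t = x a.
  have [h|//] := H N (leqnn N); by rewrite xN in h; lra.
elim: b => [|b IH] bN.
  have [->|tx] := eqVneq t (x 0%N); first by right; exists 0%N.
  by left; rewrite lt_neqAle eq_sym tx x0.
case: (IH (ltnW bN)) => [bt|]; last by right.
have [->|tx] := eqVneq t (x b.+1); first by right; exists b.+1.
left; rewrite lt_neqAle eq_sym tx leNgt; apply/negP => tb.
have /eqP : cell_of t == Some (Ordinal bN) by rewrite cell_ofP /= bt.
by rewrite tN.
Qed.

Lemma cell_length_ge0 a : 0 <= cell_length a.
Proof. by case: a => [a|] //=; rewrite subr_ge0; apply: subdivision_le; rewrite leqnSn ltn_ord. Qed.

Lemma sum_cell_length : \sum_a cell_length a = 1.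
Proof.
rewrite (bigD1 None) //= add0r.
rewrite (reindex_omap Some id) /=; last by case.
rewrite (eq_bigl xpredT); last by move=> i; rewrite eqxx.
case: sx => x0 xN _ _; transitivity (x N - x 0%N); last by rewrite xN x0 subr0.
by rewrite -(telescope_sumr x (leq0n N)) big_mkord.
Qed.

Lemma cell_type_none a : cell_type a = None -> cell_length (Some a) <= delta.
Proof.
rewrite /cell_type; case: asboolP => // nu; case: asboolP => // nd _.
by case: sx => _ _ _ /(_ a (ltn_ord a))[_ [//|/nu|/nd]].
Qed.

Lemma samecomp_cell (U : set R) a t t' : `]x a, x a.+1[ `<=` U ->
  x a < t < x a.+1 -> x a < t' < x a.+1 -> samecomp U t t'.
Proof.
move=> IU ta ta'; split; first by apply: IU; rewrite /= in_itv.
exists `]x a, x a.+1[%classic; last by rewrite /= in_itv.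
split => //.
by apply/connected_intervalP; exact: interval_is_interval.
Qed.

(** A connected set with points in two cells contains a division point between them, which is
    outside [U]. *)
Lemma not_samecomp_cells (U : set R) (a b : 'I_N) t t' : (a < b)%N ->
  (forall c, (c <= N)%N -> ~ U (x c)) ->
  x a < t < x a.+1 -> x b < t' < x b.+1 -> ~ samecomp U t t' /\ ~ samecomp U t' t.
Proof.
move=> ab xU ta tb; have xx : x a.+1 <= x b by apply: subdivision_le; rewrite ab ltnW.
have H (C : set R) : C t -> C t' -> C `<=` U -> connected C -> False.
  move=> Ct Ct' CU /connected_intervalP cC; apply: (xU a.+1); first by [].
  by apply/CU/(cC t t') => //; lra.
by split => -[_ [C [Ct CU cC] Ct']]; apply: (H C).
Qed.

(** Different cells never share a component, so there the paintbox compares the points. A cell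
    holding two points is typed, so these share a component and are ordered by index, upwards or
    downwards according to the type. For [i = j] both sides are false. *)
Lemma precedes_cells k (s : seq R) i j :
  size s = k -> uncrowded cell_type (map cell_of s) -> (i < k)%N -> (j < k)%N ->
  precedes cell_type (map cell_of s) i j <->
  ( (~ (samecomp Uu (nth 0 s i) (nth 0 s j) \/ samecomp Ud (nth 0 s i) (nth 0 s j)) /\ nth 0 s i < nth 0 s j)
       \/ (samecomp Uu (nth 0 s i) (nth 0 s j) /\ (i < j)%N)
       \/ (samecomp Ud (nth 0 s i) (nth 0 s j) /\ (j < i)%N) ).
Proof.
move=> sk sep ik jk.
have xU c : (c <= N)%N -> ~ Uu (x c) by case: sx => _ _ xK _ /xK[].
have xD c : (c <= N)%N -> ~ Ud (x c) by case: sx => _ _ xK _ /xK[].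
have disj t : Uu t -> Ud t -> False.
  by move=> tu td; have : (Uu `&` Ud) t by []; rewrite UuUd.
have := uncrowded_nth sep (_ : (i < size _)%N); rewrite size_map sk => /(_ ik).
have := uncrowded_nth sep (_ : (j < size _)%N); rewrite size_map sk => /(_ jk).
rewrite /precedes.
case jE : (nth None _ j) => [b|] // _; case iE : (nth None _ i) => [a|] // _.
have ta : x a < nth 0 s i < x a.+1 by apply: cell_of_some; rewrite -iE (nth_map 0) ?sk.
have tb : x b < nth 0 s j < x b.+1 by apply: cell_of_some; rewrite -jE (nth_map 0) ?sk.
case: (ltngtP a b) => [ab|ba|/val_inj ab] /=.
- have [nu _] := not_samecomp_cells ab xU ta tb.
  have [nd _] := not_samecomp_cells ab xD ta tb.
  split=> // _; left; split; first by case.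
  have : x a.+1 <= x b by apply: subdivision_le; rewrite ab ltnW.
  by lra.
- have [_ nu] := not_samecomp_cells ba xU tb ta.
  have [_ nd] := not_samecomp_cells ba xD tb ta.
  rewrite (_ : (a == b) = false) /=; last by apply/eqP => E; rewrite E ltnn in ba.
  split=> // -[[_ ij]|[[/nu]|[/nd]]] //.
  have : x b.+1 <= x a by apply: subdivision_le; rewrite ba ltnW.
  by lra.
subst b; rewrite eqxx /=.
have [<-|ij] := eqVneq i j.
  rewrite ltnn ltxx; case: (cell_type a) => [[]|]; rewrite ?ltnn; split => //;
  by case=> [[]|[[]|[]]].
have := uncrowded_neq sep _ _ ij iE jE; rewrite !size_map sk => /(_ ik jk).
rewrite /cell_type; case: asboolP => [cu|_].
  have su := samecomp_cell cu ta tb.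
  have nd : ~ samecomp Ud (nth 0 s i) (nth 0 s j) by move=> [td _]; exact: (disj _ su.1 td).
  move=> _; split=> [ij'|]; first by right; left.
  by case=> [[[]]|[[]|[/nd]]] //; left.
case: asboolP => [cd|_] // _.
have sd := samecomp_cell cd ta tb.
have nu : ~ samecomp Uu (nth 0 s i) (nth 0 s j) by move=> [tu _]; exact: (disj _ tu sd.1).
split=> [ij'|]; first by right; right.
by case=> [[[]]|[[/nu]|[]]] //; right.
Qed.

Lemma index_pword k (s : 'S_k) (i : 'I_k) : index (val i) (pword s) = (s^-1)%g i.
Proof.
rewrite /pword -{1}(permKV s i) (map_comp val) index_map; last exact: val_inj.
by rewrite index_map ?index_enum_ord //; exact: perm_inj.
Qed.

Lemma paint_event_cells k (s : 'S_k) (t : seq R) :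
  size t = k -> uncrowded cell_type (map cell_of t) ->
  paint_event Uu Ud s t <-> realizes cell_type (pword s) (map cell_of t).
Proof.
move=> tk sep.
have sk : size (pword s) = k by rewrite size_map size_enum_ord.
split=> [E|/realizesP H i j].
  apply/realizesP => i j; rewrite sk => ik jk.
  have Eij := E (Ordinal ik) (Ordinal jk).
  rewrite -(index_pword s (Ordinal ik)) -(index_pword s (Ordinal jk)) /= in Eij.
  apply/idP/idP => [/Eij /(precedes_cells tk sep ik jk) //|].
  by move=> /(precedes_cells tk sep ik jk)/Eij.
rewrite /= -!index_pword H ?sk; [|exact: ltn_ord|exact: ltn_ord].
exact: (precedes_cells tk sep (ltn_ord i) (ltn_ord j)).
Qed.

End CellsOfSubdivision.
End Partition.

(** * Iterated integrals of step functions *)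

(* The integral of a nonnegative function is a supremum over simple functions below
   it, so this needs no measurability. *)
Lemma ge0_le_integral_nomeas d (T : measurableType d) (R : realType)
    (mu : {measure set T -> \bar R}) (D : set T) (f g : T -> \bar R) :
  (forall t, D t -> 0 <= f t)%E -> (forall t, D t -> f t <= g t)%E ->
  (\int[mu]_(t in D) f t <= \int[mu]_(t in D) g t)%E.
Proof.
move=> f0 fg; have g0 t : D t -> (0 <= g t)%E.
  by move=> Dt; apply: le_trans (fg t Dt); exact: f0.
rewrite !ge0_integralE //; apply: ereal_sup_le => _ [h hf <-]; exists h => // t.
apply: (le_trans (hf t)); rewrite /patch; case: ifP => // tD.
by apply: fg; exact: set_mem.
Qed.

Section StepIntegral.
Variables (R : realType) (C : finType) (cell : R -> C) (l : C -> R).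
Hypothesis mcell : forall a, measurable (cell @^-1` [set a] : set (measurableTypeR R)).
Hypothesis lcell : forall a,
  lebesgue_measure (cell @^-1` [set a] `&` `[(0%R:R), 1%R]) = (l a)%:E.

Lemma cell_weight_ge0 a : 0 <= l a.
Proof. by rewrite -lee_fin -lcell. Qed.

Lemma integral_cells (g : C -> R) : (forall a, 0 <= g a) ->
  (\int[lebesgue_measure]_(t in `[(0%R:R), 1%R]) (g (cell t))%:E = (\sum_a l a * g a)%:E)%E.
Proof.
move=> g0.
have E t : ((g (cell t))%:E = \sum_(a <- index_enum C) ((g a)%:E * (\1_(cell @^-1` [set a]) t)%:E))%E.
  rewrite (bigD1_seq (cell t)) ?index_enum_uniq ?mem_index_enum //=.
  rewrite big1 ?adde0; first by rewrite indicE mem_set // mule1.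
  move=> a aN; rewrite indicE memNset ?mule0 //= => aE; by move: aN; rewrite -aE eqxx.
under eq_integral do rewrite E.
have mD : measurable (`[(0%R:R), 1%R]%classic : set R) by exact: measurable_itv.
rewrite ge0_integral_sum //; first last.
- by move=> a t _; rewrite mule_ge0 ?lee_fin.
- by move=> a; apply: measurable_funeM; apply/measurable_EFinP; apply: measurable_indic; exact: mcell.
rewrite -sumEFin; apply: eq_bigr => a _.
rewrite ge0_integralZl_EFin //; first last.
- by apply/measurable_EFinP; apply: measurable_indic; exact: mcell.
rewrite integral_indic // mulrC EFinM; congr (_ * _)%E; exact: lcell.
Qed.

Lemma wsum_ge0 k (h : seq C -> R) : (forall s, 0 <= h s) -> 0 <= wsum k (fun=> l) h.
Proof.
elim: k h => [|k IH] h h0 //=; apply: sumr_ge0 => a _.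
by rewrite mulr_ge0 ?cell_weight_ge0 // IH.
Qed.

Lemma iter_int01_lower k (f : seq R -> \bar R) (h : seq C -> R) :
  (forall s, 0 <= h s) -> (forall s, size s = k -> (h (map cell s))%:E <= f s)%E ->
  ((wsum k (fun=> l) h)%:E <= iter_int01 k f)%E.
Proof.
elim: k f h => [|k IH] f h h0 hf /=; first exact: hf.
rewrite -(@integral_cells (fun a => wsum k (fun=> l) (fun s => h (a :: s)))); last first.
  by move=> a; apply: wsum_ge0.
apply: ge0_le_integral_nomeas => t _; first by rewrite lee_fin wsum_ge0.
by apply: IH => // s sk; apply: (hf (t :: s)); rewrite /= sk.
Qed.

Lemma iter_int01_ge0 k (f : seq R -> \bar R) : (forall s, 0 <= f s)%E -> (0 <= iter_int01 k f)%E.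
Proof.
elim: k f => [|k IH] f f0 //=; apply: integral_ge0 => t _; exact: IH.
Qed.

Lemma iter_int01_upper k (f : seq R -> \bar R) (h : seq C -> R) :
  (forall s, 0 <= h s) -> (forall s, 0 <= f s)%E ->
  (forall s, size s = k -> (forall i, (i < k)%N -> 0 <= nth 0 s i <= 1) -> (f s <= (h (map cell s))%:E)%E) ->
  (iter_int01 k f <= (wsum k (fun=> l) h)%:E)%E.
Proof.
elim: k f h => [|k IH] f h h0 f0 hf /=; first exact: hf.
rewrite -(@integral_cells (fun a => wsum k (fun=> l) (fun s => h (a :: s)))); last first.
  by move=> a; apply: wsum_ge0.
apply: ge0_le_integral_nomeas => t; first by move=> _; apply: iter_int01_ge0.
rewrite /= in_itv /= => t01; apply: IH => // s sk s01; apply: (hf (t :: s)); first by rewrite /= sk.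
by case=> [|i] //= ik; exact: s01.
Qed.

End StepIntegral.

(** * Paintbox and Martin kernel *)

Section PaintProbBounds.
Variables (R : realType) (Uu Ud : set R) (delta : R) (N : nat) (x : nat -> R).
Hypothesis UuUd : Uu `&` Ud = set0.
Hypothesis sx : subdivision Uu Ud delta N x 1.

Lemma cell_of_preimage (a : 'I_N) : cell_of N x @^-1` [set Some a] = `]x a, x a.+1[%classic.
Proof.
apply/seteqP; split => t /=; rewrite in_itv /=; first exact: (cell_of_some sx).
by rewrite -(cell_ofP sx) => /eqP.
Qed.

Lemma measurable_cell_of a : measurable (cell_of N x @^-1` [set a] : set (measurableTypeR R)).
Proof.
case: a => [a|]; first by rewrite cell_of_preimage; exact: measurable_itv.
have -> : cell_of N x @^-1` [set None] = ~` \bigcup_(a in [set: 'I_N]) `]x a, x a.+1[%classic.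
  apply/seteqP; split => t /=.
    by move=> tN [a _]; rewrite -cell_of_preimage /= tN.
  move=> H; case E : (cell_of N x t) => [a|] //; exfalso; apply: H; exists a => //.
  by rewrite -cell_of_preimage.
by apply: measurableC; apply: fin_bigcup_measurable => // a _; exact: measurable_itv.
Qed.

Lemma subdivision01 a : (a <= N)%N -> 0 <= x a <= 1.
Proof. by case: sx => _ _ xK _ /xK[]. Qed.

(** Within [[0, 1]] the junk cell consists of division points only; being finite in number, they
    have measure 0, the value of [cell_length] at [None]. *)
Lemma lebesgue_cell_of a :
  lebesgue_measure (cell_of N x @^-1` [set a] `&` `[(0%R:R), 1%R]) = (cell_length x a)%:E.
Proof.
case: a => [a|] /=.
  have -> : cell_of N x @^-1` [set Some a] `&` `[(0%R:R), 1%R] = `]x a, x a.+1[%classic.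
    rewrite cell_of_preimage; apply/setIidPl => t /=; rewrite !in_itv /=.
    have := subdivision01 (ltn_ord a); have := subdivision01 (ltnW (ltn_ord a)); lra.
  rewrite lebesgue_measure_itv /= lte_fin (subdivision_lt sx) ?leqnn ?ltn_ord //.
apply: countable_lebesgue_measure0.
apply: (@sub_countable _ _ _ (x @` `I_N.+1)).
  apply: subset_card_le => t [/= tN]; rewrite in_itv /= => t01.
  by have [a aN ->] := cell_of_none sx t01 tN; exists a.
by apply: finite_set_countable; apply: finite_image; exact: finite_II.
Qed.

Lemma paint_prob_bounds k (s : 'S_k) :
  wsum k (fun=> @cell_length R N x) (lower_ind (@cell_type R Uu Ud N x) R (pword s)) <=
  paint_prob Uu Ud s <=
  wsum k (fun=> @cell_length R N x) (upper_ind (@cell_type R Uu Ud N x) R (pword s)).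
Proof.
set f := (fun t => (\1_(paint_event Uu Ud s) t)%:E) : seq R -> \bar R.
have lo := @iter_int01_lower R _ (cell_of N x) (@cell_length R N x) measurable_cell_of
  lebesgue_cell_of k f (lower_ind (@cell_type R Uu Ud N x) R (pword s)).
have up := @iter_int01_upper R _ (cell_of N x) (@cell_length R N x) measurable_cell_of
  lebesgue_cell_of k f (upper_ind (@cell_type R Uu Ud N x) R (pword s)).
have {}lo : ((wsum k (fun=> @cell_length R N x) (lower_ind (@cell_type R Uu Ud N x) R (pword s)))%:E <= iter_int01 k f)%E.
  apply: lo => [t|t tk]; first by case/andP: (lower_ind01 (@cell_type R Uu Ud N x) R (pword s) t).
  rewrite lee_fin /lower_ind; case: (boolP (uncrowded _ _)) => //= sep.
  case: (boolP (realizes _ _ _)) => //= /(paint_event_cells UuUd sx s tk sep).2 E.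
  by rewrite indicE mem_set.
have {}up : (iter_int01 k f <= (wsum k (fun=> @cell_length R N x) (upper_ind (@cell_type R Uu Ud N x) R (pword s)))%:E)%E.
  apply: up => [t|t|t tk _]; first by case/andP: (upper_ind01 (@cell_type R Uu Ud N x) R (pword s) t).
    by rewrite lee_fin.
  rewrite lee_fin /upper_ind; case: (boolP (uncrowded _ _)) => [sep|_] /=; last first.
    by rewrite indicE -[1]/(1%:R) ler_nat leq_b1.
  rewrite indicE ler_nat; case: (boolP (t \in _)) => //= /set_mem/(paint_event_cells UuUd sx s tk sep).1 -> //.
(* The iterated integral lies between two real numbers, so it is finite and [fine] returns its true
   value. *)
rewrite /paint_prob -/f; move: lo up; case: (iter_int01 k f) => [r| |] //=.
by rewrite !lee_fin => -> ->.
Qed.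

End PaintProbBounds.


Lemma pword_perms k (s : 'S_k) : pword s \in perms k.
Proof.
rewrite mem_perms; apply: uniq_perm; last 1 first.
- move=> i; rewrite mem_iota add0n; apply/mapP/idP => [[j _ ->]|ik]; first exact: ltn_ord.
  by exists ((s^-1)%g (Ordinal ik)); rewrite ?mem_enum // permKV.
- rewrite map_inj_uniq ?enum_uniq // => i j /val_inj; exact: perm_inj.
- exact: iota_uniq.
Qed.

Lemma descents_pword mu (s : 'S_(sumn mu)) : is_comp (sumn mu) mu ->
  pdes s =i Dcomp mu -> descents (pword s) = cword mu.
Proof.
move=> cm ps.
apply/eqP/(eq_descents (perms_size (pword_perms s)) (size_cword cm)) => i ik.
have := ps i.+1; rewrite (mem_Dcomp _ cm) /= => <-.
rewrite mem_filter mem_iota /= add1n ltnS.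
by rewrite ltn_predRL ik andbT.
Qed.

Lemma descents_mapS w : descents (map S w) = descents w.
Proof. by case: w => [|a r] //=; elim: r a => [|b r IH] a //=; rewrite IH ltnS. Qed.

(** A new largest letter in front adds a descent, a new smallest one an ascent. This makes the
    denominator of the Martin kernel nonzero. *)
Lemma perms_with_descents e : exists2 w, w \in perms (size e).+1 & descents w = e.
Proof.
elim: e => [|b e [w wP wE]]; first by exists [:: 0%N].
have w0 : w != [::] by have := perms_size wP; case: w {wP wE}.
case: b.
  exists ((size e).+1 :: w).
    rewrite mem_perms perm_sym -[(size (true :: e)).+1]addn1 iotaD perm_catC /= add0n perm_cons.
    by rewrite perm_sym; move: wP; rewrite mem_perms.
  case: w w0 wP wE => // a r _ wP wE; rewrite -[RHS]/(true :: e) -[in RHS]wE /=; congr (_ :: _).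
  by rewrite -(perms_mem a wP) mem_head.
exists (0%N :: map S w).
  rewrite mem_perms -[iota 0 _]/(0%N :: iota 1 (size e).+1) perm_cons.
  have -> : iota 1 (size e).+1 = map S (iota 0 (size e).+1) by exact: (iotaDl 1 0).
  apply: perm_map.
  by move: wP; rewrite mem_perms.
by rewrite -wE -[in RHS]descents_mapS; case: w w0 {wP wE}.
Qed.

Lemma count_descents_gt0 n lam : (0 < n)%N -> is_comp n lam ->
  (0 < count (fun w => descents w == cword lam) (perms n))%N.
Proof.
move=> n0 cl; rewrite -has_count; apply/hasP.
have [w wP wE] := perms_with_descents (cword lam).
by exists w; rewrite ?wE //; move: wP; rewrite (size_cword cl) prednK.
Qed.

Lemma martinKE (R : realType) n mu lam (sg : seq nat) : is_comp (sumn mu) mu -> is_comp n lam ->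
  (sumn mu <= n)%N -> sg \in perms (sumn mu) -> descents sg = cword mu ->
  martinK mu lam =
  (count (fun w => (descents w == cword lam) && has_pattern sg (iota 0 (sumn mu)) w) (perms n))%:R /
  (count (fun w => descents w == cword lam) (perms n))%:R :> R.
Proof.
move=> cm cl kn sgP sgE; have sl : sumn lam = n by case/andP: cl => _ /eqP.
rewrite /martinK /dZ sl /= subn0.
rewrite (npaths_pattern_count (k := sumn mu) cm sgP sgE) ?subnK //.
rewrite (npaths_pattern_count (k := 0) (mu := [::]) (sg := [::])) ?addn0 //.
congr (_%:R / _%:R); apply: eq_count => w.
  congr (_ && _); rewrite /has_pattern.
  have -> : [seq nth 0%N (iota 0 (sumn mu)) i | i <- sg] = sg.
    by apply: map_id_in => i; rewrite (perms_mem _ sgP) => ik; rewrite nth_iota.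
  by congr (_ == _); apply: eq_filter => y; rewrite mem_iota.
rewrite (_ : [seq y <- w | (y < 0)%N] = [::]) ?eqxx ?andbT //.
by rewrite (eq_filter (a2 := pred0)) ?filter_pred0.
Qed.

Lemma count_near (R : realType) (X Y : R) n : 0 <= Y ->
  (count (fun p : nat => `|p%:R - X| < Y) (iota 0 n))%:R <= 2 * Y + 1 :> R.
Proof.
move=> Y0; set s := [seq p <- iota 0 n | `|p%:R - X| < Y].
rewrite -size_filter -/s; case E : s => [|p0 r]; first by rewrite /=; lra.
have ss : sorted ltn s by apply: sorted_filter; [exact: ltn_trans | exact: iota_ltn_sorted].
have us : uniq s by rewrite filter_uniq // iota_uniq.
have p0s : p0 \in s by rewrite E mem_head.
have Y2 : 0 <= 2 * Y by lra.
have /andP[t1 t2] := truncn_itv Y2.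
have sub : {subset s <= iota p0 (Num.truncn (2 * Y)).+1}.
  move=> p ps; have p0p : (p0 <= p)%N.
    move: ps; rewrite E inE => /orP[/eqP -> //|pr].
    have : path ltn p0 r by move: ss; rewrite E.
    by rewrite path_sortedE => [/andP[/allP/(_ p pr)/ltnW //]|]; exact: ltn_trans.
  rewrite mem_iota p0p /= addnS ltnS -leq_subLR -ltnS -(ltr_nat R) natrB //.
  apply: le_lt_trans t2; move: p0s ps; rewrite !mem_filter => /andP[+ _] /andP[+ _].
  by rewrite !ltr_distl; lra.
rewrite -E (@le_trans _ _ (Num.truncn (2 * Y)).+1%:R) //; last by rewrite -natr1 lerD2r.
by rewrite ler_nat; have := uniq_leq_size us sub; rewrite size_iota.
Qed.

(** * Convergence *)

Section DiscreteSide.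
Variables (R : realType) (Uu Ud : set R) (delta : R) (N : nat) (x : nat -> R).
Hypothesis sx : subdivision Uu Ud delta N x 1.
Variables (n k : nat) (e : seq bool) (sg : seq nat) (eta : R).
Hypotheses (n1 : (1 < n)%N) (kn : (k < n)%N) (se : size e = n.-1) (sgP : sg \in perms k).
Hypotheses (eta01 : 0 < eta <= 1) (etan : 100 <= eta * n.-1%:R).
Let V b := compl01 (interior (@sign_segments R n e b)).
Hypotheses (nu1 : near_set eta (compl01 Uu) (V false)) (nu2 : near_set eta (V false) (compl01 Uu)).
Hypotheses (nd1 : near_set eta (compl01 Ud) (V true)) (nd2 : near_set eta (V true) (compl01 Ud)).

Let eta0 : 0 < eta. Proof. by case/andP: eta01. Qed.
Let eta1 : eta <= 1. Proof. by case/andP: eta01. Qed.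

Let N0 : 0 < n.-1%:R :> R.
Proof. by rewrite ltr0n; lia. Qed.

Let nE : n%:R = n.-1%:R + 1 :> R.
Proof. by rewrite natr1 prednK // ltnW. Qed.

Definition pos (p : nat) : R := p%:R / n.-1%:R.

Let posE p : p%:R = pos p * n.-1%:R.
Proof. by rewrite /pos divfK // gt_eqF. Qed.

Let pos01 p : (p < n)%N -> 0 <= pos p <= 1.
Proof.
move=> pn; rewrite /pos divr_ge0 ?(ltW N0) //= ler_pdivrMr // mul1r ler_nat.
by rewrite -ltnS prednK // ltnW.
Qed.

(** Positions within [3 * eta] of a division point are junk: cuts approximate division points only
    up to about [eta], and signs are known only at distance [eta] from the ends of a cell. The
    hypothesis [etan] lets [eta * n] absorb all bounded rounding errors. *)
Definition position_cell (p : nat) : option 'I_N :=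
  if [exists a : 'I_N.+1, `|pos p - x a| < 3 * eta] then None else cell_of N x (pos p).

Lemma position_cell_far p a : position_cell p != None -> (a <= N)%N ->
  pos p <= x a - 3 * eta \/ x a + 3 * eta <= pos p.
Proof.
have e0 := eta0; have e1 := eta1; have en := etan.
rewrite /position_cell; case: existsP => // H _ aN.
have : ~~ (`|pos p - x a| < 3 * eta).
  by apply/negP => h; apply: H; exists (Ordinal (aN : (a < N.+1)%N)).
by rewrite -leNgt ler_normr => /orP[h|h]; [right|left]; lra.
Qed.

Lemma position_cell_some p a : position_cell p = Some a ->
  x a + 3 * eta <= pos p <= x a.+1 - 3 * eta.
Proof.
have e0 := eta0; have e1 := eta1; have en := etan.
move=> pE; have nN : position_cell p != None by rewrite pE.
have : x a < pos p < x a.+1.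
  by apply: (cell_of_some sx); move: pE; rewrite /position_cell; case: ifP.
have := position_cell_far nN (ltn_ord a); have := position_cell_far nN (ltnW (ltn_ord a)).
by case=> ?; case=> ?; lra.
Qed.

Lemma position_cell_order p p' (a b : 'I_N) : (p < n)%N -> (p' < n)%N ->
  position_cell p = Some a -> position_cell p' = Some b -> (a < b)%N -> (p < p')%N.
Proof.
have e0 := eta0; have e1 := eta1; have en := etan.
move=> _ _ /position_cell_some pa /position_cell_some pb ab.
have : x a.+1 <= x b by apply: (subdivision_le sx); rewrite ab ltnW.
case/andP: pa pb => _ h1 /andP[h2 _] xx; have lt_pos : pos p < pos p' by lra.
by rewrite -(ltr_nat R) (posE p) (posE p') ltr_pM2r.
Qed.

Lemma position_cell_run p p' a d i : (p <= i < p')%N -> (p' < n)%N ->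
  position_cell p = Some a -> position_cell p' = Some a ->
  cell_type Uu Ud x a = Some d -> nth false e i = d.
Proof.
have e0 := eta0; have e1 := eta1; have en := etan.
move=> /andP[pi ip] pn /position_cell_some pa /position_cell_some pa' tE.
have iN : (i < n.-1)%N by rewrite ltn_predRL; exact: leq_ltn_trans ip pn.
have lo : pos p <= (i%:R + 2^-1) / n.-1%:R.
  rewrite /pos ler_pM2r ?invr_gt0 //; have : p%:R <= i%:R :> R by rewrite ler_nat.
  by lra.
have hi : (i%:R + 2^-1) / n.-1%:R <= pos p'.
  rewrite /pos ler_pM2r ?invr_gt0 //; have : i.+1%:R <= p'%:R :> R by rewrite ler_nat.
  by rewrite -natr1; lra.
have /andP[x0 _] := subdivision01 sx (ltnW (ltn_ord a)).
have /andP[_ x1] := subdivision01 sx (ltn_ord a).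
have mid : x a + eta <= (i%:R + 2^-1) / n.-1%:R <= x a.+1 - eta by case/andP: pa => ? _; case/andP: pa' => _ ?; apply/andP; split; lra.
move: tE; rewrite /cell_type; case: asboolP => [cu [<-]|_].
  exact: (run_sign n1 x0 x1 cu nu2 iN mid).
case: asboolP => // cd [<-].
exact: (run_sign n1 x0 x1 cd nd2 iN mid).
Qed.

Lemma cut_points : exists c : nat -> nat, forall a, (a <= N)%N ->
  cut_point n e (c a) /\ `|(c a)%:R - x a * n%:R| <= eta * n%:R + 8.
Proof.
have e0 := eta0; have e1 := eta1; have en := etan.
have H a : exists c, (a <= N)%N -> cut_point n e c /\ `|c%:R - x a * n%:R| <= eta * n%:R + 8.
  have [aN|aN] := leqP a N; last by exists 0%N.
  case: sx => _ _ /(_ a aN)[x01 xu xd] _.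
  have [c cc cx] := cut_point_near n1 x01 xu xd nu1 nd1.
  exists c => _; split => //.
  have n0 : 0 < n%:R :> R by rewrite ltr0n ltnW.
  have V1 : n.-1%:R^-1 <= 1 :> R.
    by rewrite invf_le1 // -[1]/(1%:R) ler_nat; lia.
  (* Source of the 8: the error [4 / n.-1] of [cut_point_near], scaled by [n], is at most
     [4 + 4]. *)
  have E : 4 / n.-1%:R * n%:R = 4 + 4 * n.-1%:R^-1 :> R by rewrite nE; field; rewrite gt_eqF.
  have cE : c%:R - x a * n%:R = (c%:R / n%:R - x a) * n%:R by rewrite mulrBl divfK ?gt_eqF.
  rewrite cE normrM (ger0_norm (ltW n0)).
  apply: (@le_trans _ _ ((eta + 4 / n.-1%:R) * n%:R)); first by rewrite ler_pM2r.
  by rewrite mulrDl E; lra.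
have [c cP] := choice H; by exists c.
Qed.

(** Off the junk, lying left of a cut and lying left of its division point are the same: of the
    margin [3 * eta], the error of the cut uses up one [eta], and the rest outweighs the bounded
    errors. *)
Lemma position_cell_cut (c : nat -> nat) p (a : 'I_N) :
  (forall a, (a <= N)%N -> `|(c a)%:R - x a * n%:R| <= eta * n%:R + 8) ->
  (p < n)%N -> position_cell p != None ->
  ((position_cell p == Some a) + (p < c a) = (p < c a.+1))%N.
Proof.
have e0 := eta0; have e1 := eta1; have en := etan.
move=> cx pn pN.
have side b : (b <= N)%N -> (p < c b)%N = (pos p < x b).
  move=> bN; have := cx b bN; rewrite ler_distl nE => /andP[h1 h2].
  have /andP[xb0 xb1] := subdivision01 sx bN.
  have pe := posE p; rewrite -(ltr_nat R) pe.
  case: (position_cell_far pN bN) => h.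
    have : pos p * n.-1%:R <= (x b - 3 * eta) * n.-1%:R by rewrite ler_pM2r.
    move=> h3; have c1 : pos p * n.-1%:R < (c b)%:R by lra.
    have c2 : pos p < x b by lra.
    by rewrite c1 c2.
  have : (x b + 3 * eta) * n.-1%:R <= pos p * n.-1%:R by rewrite ler_pM2r.
  move=> h3; have c1 : (c b)%:R <= pos p * n.-1%:R by lra.
  have c2 : x b <= pos p by lra.
  by rewrite !ltNge c1 c2.
rewrite (side _ (ltn_ord a)) (side _ (ltnW (ltn_ord a))).
case bE : (position_cell p) => [b|]; last by rewrite bE in pN.
have /andP[h h'] := position_cell_some bE.
rewrite (inj_eq Some_inj); have [<-|ba] := eqVneq b a.
  have -> : pos p < x b.+1 by lra.
  have le_b : x b <= pos p by lra.
by rewrite [pos p < x b]ltNge le_b.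
have : (b < a)%N || (a < b)%N by rewrite -neq_ltn.
move=> /orP[ab|ab].
  have xx : x b.+1 <= x a by apply: (subdivision_le sx); rewrite ab ltnW.
  have xx' : x a <= x a.+1 by apply: (subdivision_le sx); rewrite leqnSn ltn_ord.
  have -> : pos p < x a.+1 by lra.
  by have -> : pos p < x a by lra.
have xx : x a.+1 <= x b by apply: (subdivision_le sx); rewrite ab ltnW.
have xx' : x a <= x a.+1 by apply: (subdivision_le sx); rewrite leqnSn ltn_ord.
have le_a1 : x a.+1 <= pos p by lra.
rewrite [pos p < x a.+1]ltNge le_a1.
have le_a : x a <= pos p by lra.
by rewrite [pos p < x a]ltNge le_a.
Qed.

(** Each of the [N.+1] division points spoils at most [6 * eta * n.-1 + 1] positions, and [eta * n]
    absorbs the 1. *)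
Lemma count_junk :
  (count (fun p => position_cell p == None) (iota 0 n))%:R <= N.+1%:R * (7 * eta * n%:R) :> R.
Proof.
have e0 := eta0; have e1 := eta1; have en := etan.
have H : (count (fun p => position_cell p == None) (iota 0 n) <=
    \sum_(a < N.+1) count (fun p : nat => (`|p%:R - x a * n.-1%:R| < 3 * eta * n.-1%:R)%R) (iota 0 n))%N.
  under eq_bigr do rewrite -sum1_count big_mkcond.
  rewrite exchange_big /= -sum1_count big_mkcond big_seq [leqRHS]big_seq.
  apply: leq_sum => p; rewrite mem_iota add0n => pn; case: ifP => // /eqP pE.
  have [a pa] : exists a : 'I_N.+1, `|pos p - x a| < 3 * eta.
    move: pE; rewrite /position_cell; case: existsP => // nex cN.
    have [a aN pa] := cell_of_none sx (pos01 pn) cN.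
    by exists (Ordinal (aN : (a < N.+1)%N)); rewrite /= pa subrr normr0; lra.
  rewrite (bigD1 a) //= (posE p) -mulrBl normrM (gtr0_norm N0) ltr_pM2r // pa.
  by rewrite addn_gt0.
move: H; rewrite -(ler_nat R) => /le_trans; apply; rewrite natr_sum.
apply: (@le_trans _ _ (\sum_(a < N.+1) 7 * eta * n%:R)).
  apply: ler_sum => a _; apply: (le_trans (count_near _ _ _)).
    by rewrite !mulr_ge0 //; lra.
  by rewrite nE; lra.
by rewrite sumr_const card_ord -[leLHS]mulr_natl.
Qed.

(** From [freq_close] with [d = eta]: the deviations [8 * eta * n] and the junk, [7 * eta * n] per
    division point, are divided by the block size, which is at least [n] over [2 * k.+1]; the final
    4 is [rho / eta]. *)
Definition mesh_constant : R := 2 * k.+1%:R * (8 + 7 * N.+1%:R) + 4.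

Lemma block_size_ge : n%:R / (n %/ k.+1)%:R <= 2 * k.+1%:R :> R.
Proof.
have e0 := eta0; have e1 := eta1; have en := etan.
have m0 : (0 < n %/ k.+1)%N by rewrite divn_gt0.
rewrite ler_pdivrMr ?ltr0n // (_ : _ * _ = (2 * k.+1 * (n %/ k.+1))%:R) ?ler_nat; last by rewrite !natrM.
have := ltn_ceil n (ltn0Sn k); move: m0; set m := (n %/ k.+1)%N => m0 /ltnW h.
by apply: (leq_trans h); rewrite mulnAC leq_mul2r; apply/orP; right; lia.
Qed.

Lemma discrete_sandwich t : t%:R <= eta * n%:R ->
  let A : R := (count (fun w => descents w == e) (perms n))%:R in
  let B : R := (count (fun w => (descents w == e) && has_pattern sg (iota 0 k) w) (perms n))%:R in
  let err := k%:R * N.+1%:R * (mesh_constant * eta) +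
    N.+1%:R * k.+1%:R * (n%:R * n.+1%:R * (1 - eta) ^+ t) in
  (wsum k (fun=> @cell_length R N x) (lower_ind (@cell_type R Uu Ud N x) R sg) - err) * A <= B /\
  B <= (wsum k (fun=> @cell_length R N x) (upper_ind (@cell_type R Uu Ud N x) R sg) + err) * A.
Proof.
have e0 := eta0; have e1 := eta1; have en := etan.
move=> tn; cbv zeta; apply/andP.
have n0 : 0 < n%:R :> R by rewrite ltr0n ltnW.
have m0 : 0 < (n %/ k.+1)%:R :> R by rewrite ltr0n divn_gt0.
have [c cP] := cut_points.
have cx a : (a <= N)%N -> `|(c a)%:R - x a * n%:R| <= eta * n%:R + 8 by move=> /cP[].
apply: (@pattern_count_sandwich R n k e sg N (cell_type Uu Ud x) position_cell sgP se kn
  position_cell_order position_cell_run (cell_length x) (mesh_constant * eta) _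
  (deviates n k N c eta)).
- exact: (cell_length_ge0 sx).
- by rewrite (sum_cell_length sx).
- rewrite mulr_ge0 ?(ltW eta0) // /mesh_constant addr_ge0 // !mulr_ge0 // addr_ge0 // mulr_ge0 //.
- rewrite !mulr_ge0 // exprn_ge0 // subr_ge0; lra.
- move=> w i a wP dw nb ik.
  have := @freq_close R n k N position_cell c eta (N.+1%:R * (7 * eta * n%:R)) (4 * eta)
    (cell_length x) w i a kn wP ik.
  move=> /(_ (fun p a pn pN => position_cell_cut a cx pn pN) count_junk erefl).
  (* Two cut errors [eta * n + 8], divided by [n], where [16 / n <= 2 * eta] by [etan]. *)
  have rho (b : 'I_N) : `|((c b.+1)%:R - (c b)%:R) / n%:R - @cell_length R N x (Some b)| <= 4 * eta.
    rewrite /cell_length.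
    have := cx _ (ltn_ord b); have := cx _ (ltnW (ltn_ord b)); rewrite !ler_distl.
    move=> /andP[h1 h2] /andP[h3 h4]; rewrite ler_pdivlMr // ler_pdivrMr //.
    by rewrite nE in h1 h2 h3 h4 *; apply/andP; split; lra.
  move=> /(_ rho); rewrite mulr_ge0 ?(ltW eta0) // => /(_ isT isT nb)/le_trans; apply.
  rewrite (_ : _ + N.+1%:R * _ = (8 + 7 * N.+1%:R) * eta * n%:R); last by ring.
  rewrite /mesh_constant [leRHS]mulrDl lerD2r -[leLHS]mulrA [leRHS](_ : _ = (8 + 7 * N.+1%:R) * eta * (2 * k.+1%:R)); last by ring.
  rewrite ler_wpM2l ?block_size_ge // mulr_ge0 ?(ltW eta0) // addr_ge0 // mulr_ge0 //.
- apply: count_deviates => //; first by rewrite ltnW.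
  by move=> a /cP[].
Qed.

End DiscreteSide.

Lemma pow_decay (R : realType) (eta : R) r : 0 < eta <= 1 ->
  (1 - eta) ^+ r <= (1 + r%:R * eta)^-1.
Proof.
move=> /andP[e0 e1].
have b : 1 + r%:R * eta <= (1 + eta) ^+ r.
  elim: r => [|r IH]; first by rewrite mul0r addr0 expr0.
  rewrite exprS -natr1; apply: (@le_trans _ _ ((1 + eta) * (1 + r%:R * eta))).
    have : 0 <= r%:R * eta * eta :> R by rewrite !mulr_ge0 // ltW.
    lra.
  by rewrite ler_pM2l //; lra.
have p0 : 0 < 1 + r%:R * eta by rewrite ltr_pwDl // mulr_ge0 // ltW.
have q0 : 0 < (1 + eta) ^+ r by exact: lt_le_trans b.
apply: (@le_trans _ _ ((1 + eta) ^+ r)^-1); last by rewrite lef_pV2.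
rewrite -[leRHS]mul1r ler_pdivlMr // -exprMn exprn_ile1 //.
  by rewrite mulr_ge0 //; lra.
have : 0 <= eta * eta by rewrite mulr_ge0 // ltW.
lra.
Qed.

(** The exponent is [4 * r] with [r] the integer part of [eta * n / 4]: Bernoulli's inequality
    bounds the power [r] by the inverse of [q * n], and the fourth power of this beats
    [n * n.+1]. *)
Lemma decay_eventually (R : realType) (eta eps : R) : 0 < eta <= 1 -> 0 < eps ->
  exists n0, forall n, (n0 <= n)%N ->
    exists2 t, t%:R <= eta * n%:R & n%:R * n.+1%:R * (1 - eta) ^+ t <= eps.
Proof.
move=> e01 eps0; have /andP[e0 e1] := e01.
pose q := eta ^+ 2 / 4.
have q0 : 0 < q by rewrite /q divr_gt0 // exprn_gt0.
pose M := 2 / (q ^+ 4 * eps).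
have M0 : 0 <= M by rewrite /M divr_ge0 // mulr_ge0 ?(ltW eps0) // exprn_ge0 // ltW.
exists (Num.truncn M).+2 => n nM.
have n0 : 0 < n%:R :> R by rewrite ltr0n; exact: leq_trans nM.
have nM' : M <= n%:R.
  have /andP[_ /ltW h] := truncn_itv M0; apply: (le_trans h); rewrite ler_nat; exact: ltnW.
have nn1 : 1 <= n%:R :> R by rewrite -[1]/(1%:R) ler_nat; exact: leq_trans nM.
have X0 : 0 <= eta * n%:R / 4 by rewrite divr_ge0 // mulr_ge0 // ltW.
have /andP[r1 r2] := truncn_itv X0; set r := Num.truncn _ in r1 r2.
exists (4 * r)%N; first by rewrite natrM; lra.
have B : q * n%:R <= 1 + r%:R * eta.
  have : eta * (eta * n%:R / 4) <= eta * r.+1%:R by rewrite ler_pM2l // ltW.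
  rewrite /q -natr1 expr2; lra.
have qn : 0 < q * n%:R by rewrite mulr_gt0.
have D : (1 - eta) ^+ (4 * r) <= ((q * n%:R) ^+ 4)^-1.
  rewrite mulnC exprM -exprVn; apply: lerXn2r; rewrite ?nnegrE.
  - by rewrite exprn_ge0 // subr_ge0.
  - by rewrite invr_ge0 ltW.
  by apply: (le_trans (pow_decay r e01)); rewrite lef_pV2 // posrE; exact: lt_le_trans B.
apply: (@le_trans _ _ (n%:R * (2 * n%:R) * ((q * n%:R) ^+ 4)^-1)).
  apply: ler_pM => //; first by rewrite exprn_ge0 // subr_ge0.
  by rewrite ler_pM2l // -natr1; lra.
rewrite ler_pdivrMr ?exprn_gt0 // exprMn.
have : 2 <= eps * q ^+ 4 * n%:R.
  by move: nM'; rewrite /M ler_pdivrMr ?mulr_gt0 ?exprn_gt0 //; lra.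
have Q0 : 0 <= q ^+ 4 by rewrite exprn_ge0 // ltW.
set Q := q ^+ 4 in Q0 * => h.
have h2 : n%:R * n%:R * 2 <= n%:R * n%:R * (eps * Q * n%:R) by rewrite ler_wpM2l // mulr_ge0.
apply: (le_trans (_ : _ <= n%:R * n%:R * (eps * Q * n%:R))); first by move: h2; lra.
rewrite [leRHS](_ : _ = n%:R * (n%:R * n%:R * (eps * Q * n%:R))); last by ring.
by rewrite -[leLHS]mul1r ler_wpM2r // !mulr_ge0 // ltW.
Qed.

Theorem theorem8 (R : realType) (lam : nat -> seq nat) (Uu Ud : set R) :
  (forall n : nat, (2 <= n)%N -> is_comp n (lam n)) ->
  open Uu -> open Ud ->
  Uu `<=` `]0, 1[ -> Ud `<=` `]0, 1[ -> Uu `&` Ud = set0 ->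
  (fun n : nat => dU2 (Ulam R (lam n)) (Uu, Ud)) @ \oo --> (0 : R) ->
  forall mu : seq nat, is_comp (sumn mu) mu ->
  forall s : 'S_(sumn mu), pdes s =i Dcomp mu ->
  (fun n : nat => martinK (R := R) mu (lam n)) @ \oo --> paint_prob Uu Ud s.
Proof.
move=> lamP oU oD U01 D01 UD cv mu cm s ps.
apply/cvgrPdist_le => eps eps0.
have k2 : 0 <= (sumn mu)%:R ^+ 2 :> R by rewrite exprn_ge0.
(* Half of [eps] is reserved for crowded configurations, of weight at most [k ^ 2 * delta]; the
   [+ 1] covers [k = 0]. *)
pose delta : R := eps / (2 * ((sumn mu)%:R ^+ 2 + 1)).
have delta0 : 0 < delta by rewrite divr_gt0 // mulr_gt0 //; lra.
have kdelta : (sumn mu)%:R ^+ 2 * delta <= eps / 2.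
  by rewrite /delta mulrA ler_pdivrMr ?mulr_gt0 //; lra.
(* The subdivision depends on the limit sets and [delta] only, so [N] is fixed before [eta] and [n]
   are chosen. *)
have [N [x sx]] := subdivision_exists oU oD U01 D01 UD delta0.
have pb := paint_prob_bounds UD sx s.
have LU := @wsum_upper_lower N (cell_type Uu Ud x) R (sumn mu) (pword s) (cell_length x) delta
  (cell_length_ge0 sx) _ erefl (ltW delta0) (@cell_type_none _ _ _ _ _ _ sx).
rewrite (sum_cell_length sx) in LU; have {}LU := LU (lexx 1).
pose M : R := (sumn mu)%:R * N.+1%:R * mesh_constant R N (sumn mu).
have M0 : 0 <= M.
  rewrite /M /mesh_constant !mulr_ge0 // addr_ge0 // !mulr_ge0 // addr_ge0 // mulr_ge0 //.
(* A quarter of [eps] pays for the errors in the cell frequencies; the last quarter goes to the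
   exceptional permutations, for [n] large. *)
pose eta : R := Num.min 1 (eps / (4 * (M + 1))).
have q0 : 0 < eps / (4 * (M + 1)) by rewrite divr_gt0 // mulr_gt0 //; lra.
have eta0 : 0 < eta by rewrite /eta lt_min q0 ltr01.
have eta1 : eta <= 1 by rewrite /eta ge_min lexx.
have eta01 : 0 < eta <= 1 by rewrite eta0.
have Meta : M * eta <= eps / 4.
  apply: (@le_trans _ _ (M * (eps / (4 * (M + 1))))).
    by rewrite ler_wpM2l // /eta ge_min lexx orbT.
  by rewrite mulrA ler_pdivrMr ?mulr_gt0 //; lra.
have W0 : 0 < N.+1%:R * (sumn mu).+1%:R :> R by rewrite mulr_gt0.
have eps'0 : 0 < eps / 4 / (N.+1%:R * (sumn mu).+1%:R) by rewrite !divr_gt0.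
have [n0 n0P] := decay_eventually eta01 eps'0.
have {}cv : \forall n \near \oo, dU2 (Ulam R (lam n)) (Uu, Ud) < eta.
  move/cvgrPdist_lt: cv => /(_ eta eta0); apply: filterS => n.
  by rewrite sub0r normrN; exact: le_lt_trans (ler_norm _).
near=> n.
have n0n : (n0 <= n)%N by near: n; exact: nbhs_infty_ge.
have n2 : (2 <= n)%N by near: n; exact: nbhs_infty_ge.
have kn : (sumn mu < n)%N by near: n; exact: nbhs_infty_ge.
have nbig : ((Num.truncn (100 / eta)).+2 <= n)%N by near: n; exact: nbhs_infty_ge.
have dn : dU2 (Ulam R (lam n)) (Uu, Ud) < eta by near: n; exact: cv.
have etan : 100 <= eta * n.-1%:R.
  rewrite mulrC -ler_pdivrMr //.
  have /andP[_ /ltW h] := truncn_itv (ltW (divr_gt0 (ltr0n R 100) eta0)).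
  by apply: (le_trans h); rewrite ler_nat -ltnS prednK // ltnW.
have cl := lamP n n2.
have V01 b : interior (@sign_segments R n (cword (lam n)) b) `<=` `]0, 1[.
  by apply: interior_sub_itv; exact: sign_segments01.
move: dn; rewrite (UlamE R cl) /dU2 /= gt_max => /andP[du dd].
have [nu2 nu1] := near_set_hausdorff (@compl01_sub _ _) (@compl01_sub _ _)
  (compl01_nonempty (V01 false)) (compl01_nonempty U01) du.
have [nd2 nd1] := near_set_hausdorff (@compl01_sub _ _) (@compl01_sub _ _)
  (compl01_nonempty (V01 true)) (compl01_nonempty D01) dd.
have [t tn tdecay] := n0P n n0n.
have := discrete_sandwich sx n2 kn (size_cword cl) (pword_perms s) eta01 etan nu1 nu2 nd1 nd2 tn.
cbv zeta.
rewrite (martinKE R cm cl (ltnW kn) (pword_perms s) (descents_pword cm ps)).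
have A0 : 0 < (count (fun w => descents w == cword (lam n)) (perms n))%:R :> R.
  by rewrite ltr0n count_descents_gt0 // ltnW.
have Wd : N.+1%:R * (sumn mu).+1%:R * (n%:R * n.+1%:R * (1 - eta) ^+ t) <= eps / 4.
  by rewrite mulrC -ler_pdivlMr.
set A := (count _ (perms n))%:R in A0 *; set B := (count _ (perms n))%:R.
move=> [lo hi]; rewrite -ler_pdivlMr // in lo; rewrite -ler_pdivrMr // in hi.
move: lo hi pb LU; rewrite mulrA -/M.
(* The paintbox probability lies in [[L, U]], the kernel in this interval enlarged by [eps / 2] on
   both sides, and [U - L] is at most [eps / 2]. *)
set L := wsum _ _ _; set U := wsum _ _ _ => lo hi /andP[pb1 pb2] LU.
by rewrite ler_distl; apply/andP; split; lra.
Unshelve. all: by end_near.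
Qed.
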